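(* Let $d\ge 1$, let $f\in C^2([0,1];\mathbf{R}^d)$ satisfy the $\alpha$-nonlinearity assumption: there exist $\alpha\in(0,1]$ and $C>0$ such that, for every $(\tau,\xi)\in\mathbf{R}\times\mathbf{R}^d$ with $|(\tau,\xi)|=1$ and every $\delta>0$, $$\mathcal{L}^1\big(\{v\in[0,1] : |\tau+f'(v)\cdot\xi|<\delta\}\big)\le C\delta^\alpha .$$ Let $g\in L^\infty(\mathbf{R}\times\mathbf{R}^d)$ and let $u\in C(\mathbf{R}\times\mathbf{R}^d;[0,1])$ be a continuous and isentropic solution of the scalar balance law $\partial_t u+\mathrm{div}_x f(u)=g$. Then, for any $t\in\mathbf{R}$, the function $u(t,\cdot)$ is $\overline{\gamma}$-Hölder continuous in space with $$\overline{\gamma}=\frac{\alpha}{2d}.$$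
   Context: $\mathcal{L}^1$ is Lebesgue measure on $\mathbf{R}$. Solutions are understood in the sense of distributions on $\mathbf{R}\times\mathbf{R}^d$, with $t\in\mathbf{R}$ and $x\in\mathbf{R}^d$. A continuous solution $u$ with values in $[0,1]$ is isentropic if for every entropy-entropy flux pair $(\eta,q)$ (that is, $\eta$ is convex and differentiable and $q'(v)=\eta'(v)f'(v)$ for every $v$, with $q$ taking values in $\mathbf{R}^d$) one has $\partial_t\eta(u)+\mathrm{div}_x q(u)=\eta'(u)\,g$ in the sense of distributions. *)

(* Defs.v *)
From HB Require Import structures.
From mathcomp Require Import all_boot all_order all_algebra.
From mathcomp Require Import all_classical all_reals all_analysis.

Set Implicit Arguments.
Unset Strict Implicit.
Unset Printing Implicit Defensive.

Import Order.TTheory GRing.Theory Num.Theory.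
Import numFieldNormedType.Exports.

Local Open Scope classical_set_scope.
Local Open Scope ring_scope.

Definition measure_rV_display : measure_display -> measure_display.
Proof. exact. Qed.

Section measurable_rV.
Context {d} {T : measurableType d}.
Variable n : nat.

Let coors : 'I_n -> 'rV[T]_n -> T := fun i x => x ord0 i.

Let rV_set0 : g_sigma_preimage coors set0.
Proof. exact: sigma_algebra0. Qed.

Let rV_setC A : g_sigma_preimage coors A -> g_sigma_preimage coors (~` A).
Proof. exact: sigma_algebraC. Qed.

Let rV_bigcup (F : _^nat) : (forall i, g_sigma_preimage coors (F i)) ->
  g_sigma_preimage coors (\bigcup_i (F i)).
Proof. exact: sigma_algebra_bigcup. Qed.

(* The product sigma-algebra, i.e. the one generated by the coordinates; for
   [T] the reals it is the Borel sigma-algebra of the usual topology. *)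
HB.instance Definition _ := @isMeasurable.Build (measure_rV_display d)
  'rV[T]_n (g_sigma_preimage coors) rV_set0 rV_setC rV_bigcup.

End measurable_rV.

Lemma measurable_coord d (T : measurableType d) n (i : 'I_n) :
  measurable_fun [set: 'rV[T]_n] (fun x => x ord0 i).
Proof.
move=> _ Y mY; rewrite setTI; apply: sub_sigma_algebra => /=.
rewrite -bigcup_seq/=; exists i => /=; first by rewrite mem_index_enum.
by exists Y => //; rewrite setTI.
Qed.

Lemma measurable_fun_rVP d1 d2 (T1 : measurableType d1) (T2 : measurableType d2)
    n (f : T1 -> 'rV[T2]_n) :
  measurable_fun [set: T1] f <->
  forall i, measurable_fun [set: T1] (fun x => f x ord0 i).
Proof.
split=> [mf i|mf]; first exact: (measurableT_comp (measurable_coord i) mf).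
apply: (@measurability _ _ _ _ setT f
  (\big[setU/set0]_(i < n)
     preimage_set_system setT (fun v : 'rV[T2]_n => v ord0 i) measurable)) => //.
move=> _ [B + <-]; rewrite -bigcup_seq => -[i _ [C mC <-]].
have := mf i measurableT C mC.
by rewrite !setTI.
Qed.

(* The sigma-finite instance that the library declares on [m1 \x m2] is shadowed
   by the one for subprobabilities, so sigma-finiteness is restated here. *)
Lemma product_measure_sigma_finite d1 d2 (T1 : measurableType d1)
    (T2 : measurableType d2) (R : realType)
    (m1 : {sigma_finite_measure set T1 -> \bar R})
    (m2 : {sigma_finite_measure set T2 -> \bar R}) :
  sigma_finite setT (m1 \x m2)%E.
Proof.
have /sigma_finiteP[F [TF ndF Foo]] := sigma_finiteT m1.
have /sigma_finiteP[G [TG ndG Goo]] := sigma_finiteT m2.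
exists (fun n => F n `*` G n).
  rewrite -setXTT TF TG predeqE => -[x y]; split.
    move=> [/= [n _ Fnx] [k _ Gky]]; exists (maxn n k) => //; split.
    - by move: x Fnx; exact/subsetPset/ndF/leq_maxl.
    - by move: y Gky; exact/subsetPset/ndG/leq_maxr.
  by move=> [n _ []/= ? ?]; split; exists n.
move=> k; have [? ?] := Foo k; have [? ?] := Goo k.
split; first exact: measurableX.
by rewrite product_measure1E// lte_mul_pinfty// ge0_fin_numE.
Qed.

Section lebesgue_rV.
Context {R : realType}.

Definition rV_cons n (p : R * 'rV[R]_n) : 'rV[R]_n.+1 :=
  \row_i (if unlift ord0 i is Some j then p.2 ord0 j else p.1).

Definition rV_uncons n (v : 'rV[R]_n.+1) : R * 'rV[R]_n :=
  (v ord0 ord0, \row_j v ord0 (lift ord0 j)).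

Lemma rV_consK n : cancel (@rV_cons n) (@rV_uncons n).
Proof.
move=> [x v]; rewrite /rV_cons /rV_uncons /=; congr pair.
  by rewrite mxE unlift_none.
by apply/rowP => j; rewrite !mxE liftK.
Qed.

Lemma rV_unconsK n : cancel (@rV_uncons n) (@rV_cons n).
Proof.
move=> v; rewrite /rV_cons /rV_uncons /=; apply/rowP => i; rewrite mxE.
by case: unliftP => [j ->|->]; rewrite ?mxE.
Qed.

Lemma measurable_rV_cons n : measurable_fun [set: R * 'rV[R]_n] (@rV_cons n).
Proof.
apply/measurable_fun_rVP => i; case: (unliftP ord0 i) => [j ->|->].
  rewrite (_ : (fun x => _) = (fun v : 'rV[R]_n => v ord0 j) \o snd).
    exact: measurableT_comp (measurable_coord j) measurable_snd.
  by apply/funext => x /=; rewrite mxE liftK.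
rewrite (_ : (fun x => _) = fst); first exact: measurable_fst.
by apply/funext => x /=; rewrite mxE unlift_none.
Qed.

Lemma measurable_rV_uncons n : measurable_fun [set: 'rV[R]_n.+1] (@rV_uncons n).
Proof.
apply/measurable_fun_pairP; split; first exact: measurable_coord.
apply/measurable_fun_rVP => i.
rewrite (_ : (fun x => _) = fun x : 'rV[R]_n.+1 => x ord0 (lift ord0 i)).
  exact: measurable_coord.
by apply/funext => x /=; rewrite mxE.
Qed.

Section step.
Variables (n : nat) (mu : {sigma_finite_measure set 'rV[R]_n -> \bar R}).

Definition lebesgue_rV_step : set 'rV[R]_n.+1 -> \bar R :=
  pushforward (lebesgue_measure \x mu)%E (@rV_cons n).

Let step0 : lebesgue_rV_step set0 = 0%E.
Proof. by rewrite /lebesgue_rV_step /pushforward preimage_set0 measure0. Qed.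

Let step_ge0 A : (0 <= lebesgue_rV_step A)%E.
Proof. by rewrite /lebesgue_rV_step /pushforward; exact: measure_ge0. Qed.

Let measurable_preimage_cons (A : set 'rV[R]_n.+1) : measurable A ->
  @measurable _ (measurableTypeR R * 'rV[R]_n)%type (@rV_cons n @^-1` A).
Proof. by move=> mA; have := measurable_rV_cons measurableT mA; rewrite setTI. Qed.

Let step_sigma_additive : semi_sigma_additive lebesgue_rV_step.
Proof.
move=> F mF tF mUF; rewrite /lebesgue_rV_step /pushforward preimage_bigcup.
apply: measure_semi_sigma_additive.
- by move=> k; exact: measurable_preimage_cons.
- apply/trivIsetP => /= i j _ _ ij; rewrite -preimage_setI.
  by move/trivIsetP : tF => /(_ _ _ _ _ ij) ->//; rewrite preimage_set0.
- by rewrite -preimage_bigcup; exact: measurable_preimage_cons.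
Qed.

HB.instance Definition _ := isMeasure.Build _ _ _ lebesgue_rV_step
  step0 step_ge0 step_sigma_additive.

Let step_sigma_finite : sigma_finite setT lebesgue_rV_step.
Proof.
have [F FT Foo] := product_measure_sigma_finite (@lebesgue_measure R) mu.
exists (fun k => @rV_uncons n @^-1` F k).
  by rewrite -preimage_bigcup -FT preimage_setT.
move=> k; have [mFk Fkoo] := Foo k; split.
  by have := measurable_rV_uncons measurableT mFk; rewrite setTI.
rewrite /lebesgue_rV_step /pushforward -comp_preimage.
by rewrite (_ : _ \o _ = id)//; apply/funext => x /=; rewrite rV_consK.
Qed.

HB.instance Definition _ := Measure_isSigmaFinite.Build _ _ _ lebesgue_rV_step
  step_sigma_finite.

End step.

(* [R^(n+1)] is identified with [R * R^n] by splitting off the first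
   coordinate; in dimension 0 the measure has mass 1 at the only point. *)
Fixpoint lebesgue_rV n : {sigma_finite_measure set 'rV[R]_n -> \bar R} :=
  match n with
  | 0 => \d_(0 : 'rV[R]_0)
  | n'.+1 => lebesgue_rV_step (lebesgue_rV n')
  end.

End lebesgue_rV.
Arguments lebesgue_rV : clear implicits.

Section lebesgue_tx.
Variables (R : realType) (d : nat).

Definition lebesgue_tx : set (measurableTypeR R * 'rV[R]_d) -> \bar R :=
  (lebesgue_measure \x lebesgue_rV R d)%E.

HB.instance Definition _ := Measure.on lebesgue_tx.

HB.instance Definition _ := Measure_isSigmaFinite.Build _ _ _ lebesgue_tx
  (product_measure_sigma_finite (@lebesgue_measure R) (lebesgue_rV R d)).

End lebesgue_tx.
Arguments lebesgue_tx : clear implicits.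

(* At an endpoint of an interval [A] these are the one-sided notions. *)
Section derive_in.
Variables (R : realType) (V : normedModType R).
Implicit Types (A : set R) (f : R -> V) (v : R).

Definition derivable_in A f v : Prop :=
  cvg ((w - v)^-1 *: (f w - f v) @[w --> within A v^']).

Definition derive_in A f v : V :=
  lim ((w - v)^-1 *: (f w - f v) @[w --> within A v^']).

Definition C2_in A f : Prop :=
  [/\ {in A, forall v, derivable_in A f v},
      {in A, forall v, derivable_in A (derive_in A f) v} &
      {within A, continuous (derive_in A (derive_in A f))}].

End derive_in.

Section euclidean.
Variables (R : realType) (d : nat).
Implicit Types x y : 'rV[R]_d.

Definition dotr x y : R := \sum_(i < d) x ord0 i * y ord0 i.

(* The library norm on row vectors is the maximum norm. *)
Definition enorm x : R := Num.sqrt (dotr x x).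

Definition hoelder_continuous (gamma : R) (w : 'rV[R]_d -> R) : Prop :=
  exists C : R, forall x y, `|w x - w y| <= C * enorm (x - y) `^ gamma.

End euclidean.

Section distributions.
Variables (R : realType) (d : nat).
Local Notation tx := (R * 'rV[R]_d)%type.

(* [phi] is C^oo iff all its iterated directional derivatives are (Fréchet)
   differentiable everywhere. *)
Definition smooth (phi : tx -> R) : Prop :=
  forall (s : seq tx) (z : tx),
    differentiable (foldr (fun v h => 'D_v h) phi s) z.

Definition test_function (phi : tx -> R) : Prop :=
  smooth phi /\ compact (closure [set z | phi z != 0]).

Definition partial_t (phi : tx -> R) : tx -> R := 'D_((1, 0) : tx) phi.

Definition partial_x (i : 'I_d) (phi : tx -> R) : tx -> R :=
  'D_((0, delta_mx ord0 i) : tx) phi.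

(* Weak form of [d_t E + div_x F = S]. *)
Definition distributional_balance
    (E : tx -> R) (F : tx -> 'rV[R]_d) (S : tx -> R) : Prop :=
  forall phi : tx -> R, test_function phi ->
    - (\int[lebesgue_tx R d]_z
         (E z * partial_t phi z + \sum_(i < d) F z ord0 i * partial_x i phi z))
    = \int[lebesgue_tx R d]_z (S z * phi z).

Variables (f : R -> 'rV[R]_d) (g : tx -> R).

Definition alpha_nonlinear (alpha : R) : Prop :=
  0 < alpha <= 1 /\
  exists2 C : R, 0 < C &
    forall (tau : R) (xi : 'rV[R]_d) (delta : R),
      Num.sqrt (tau ^+ 2 + dotr xi xi) = 1 -> 0 < delta ->
      let E := [set v : R | v \in `[0, 1] /\
                 `|tau + dotr (derive_in `[0, 1] f v) xi| < delta] in
      (lebesgue_measure E <= (C * delta `^ alpha)%:E)%E.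

Definition balance_solution (u : tx -> R) : Prop :=
  distributional_balance u (f \o u) g.

(* Only the values of entropies and fluxes on [0, 1], the range of the
   solutions, matter; there every convex differentiable function extends to a
   convex differentiable function on the line. *)
Definition entropy_flux_pair (eta : R -> R) (q : R -> 'rV[R]_d) : Prop :=
  convex_function (`[0, 1] : set R) eta /\
  {in `[0, 1], forall v,
    [/\ derivable_in `[0, 1] eta v, derivable_in `[0, 1] q v &
        derive_in `[0, 1] q v = derive_in `[0, 1] eta v *: derive_in `[0, 1] f v]}.

Definition isentropic (u : tx -> R) : Prop :=
  forall (eta : R -> R) (q : R -> 'rV[R]_d), entropy_flux_pair eta q ->
    distributional_balance (eta \o u) (q \o u)
      (fun z => derive_in `[0, 1] eta (u z) * g z).

End distributions.

(* Main.v *)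
(** Let [G] bound [|g|], let [L] be a Lipschitz constant of [f'], and suppose
    [u (t, x) >= v].  Testing the entropy balance, in a space-time box that
    moves with velocity [f' v] and widens at rate [O(L G |s|)], against an
    entropy whose derivative behaves like [exp (lam w)] on
    [v - O(G |s|), v] and vanishes outside, and letting [lam] go to infinity,
    one finds [y] with [|y - x - s f' v| <= 3 L G s^2] and
    [u (t + s, y) >= v - 2 G |s|]; here [s] may have either sign.

    Following the velocity [f' v] for a time [s] and then [f' w], with [w <= v],
    for a time [- s], moves lower bounds of [u (t, .)] by [s (f' v - f' w)] at
    the price of a loss [O(v - w + |s|)] in value and an error [O(s^2)] in
    position.  By nonlinearity, [d] disjoint subintervals of a value interval of
    length [h] contain pairs [(v, w)] whose differences [f' v - f' w] form a
    matrix with determinant at least of order [h^(d/alpha)].  Hence a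
    displacement of size [c h^(2d/alpha)] is realized with times of order
    [c h^(d/alpha)], and the quadratic error is again at most a small multiple
    of [c h^(2d/alpha)]: repeating with [h/2], [h/4], ... and using the
    continuity of [u], one reaches the target exactly with total loss [h]. *)
Require Import Defs.
From HB Require Import structures.
From mathcomp Require Import all_boot all_order all_algebra.
From mathcomp Require Import all_classical all_reals all_analysis.
From mathcomp Require Import perm measurable_realfun ess_sup_inf ring lra.
Import Order.TTheory GRing.Theory Num.Theory.
Import numFieldNormedType.Exports.
Local Open Scope classical_set_scope.
Local Open Scope ring_scope.

Set Implicit Arguments.
Unset Strict Implicit.
Unset Printing Implicit Defensive.

(** * Lebesgue measure of space-time boxes *)

(** The velocity field [f' (u)] is merely continuous, so its characteristics are not at hand to
    transport values. The exponential entropy replaces them: its derivative is [lam] times itself up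
    to a small remainder, so a source bounded by [G] costs at most a factor [exp (lam * G * s)],
    which loses against the entropy [exp (lam * (b - a))] of the starting value once
    [b - a > G * s]. The derivative of the entropy lives on a short value interval, so only speeds
    close to [f' v] enter; this dictates the widening rate. Isentropy is an equality: it is linear
    in the entropy, which admits differences of convex entropies, and it has no preferred time
    direction, so the estimate also runs backwards.

    The exponent comes from a balance. Cramer's rule realizes a displacement of size [Y] with times
    of order [Y / delta^d]. The resulting error [Y^2 / delta^(2d)] is a small fraction of [Y] only
    if [Y] is a small multiple of [delta^(2d)], and nonlinearity allows [delta] of order
    [h^(1/alpha)]. Lower bounds suffice because the two points compared can be exchanged. *)

Section tx_measure.
Context {R : realType} {d : nat}.
Local Notation tx := (measurableTypeR R * 'rV[R]_d)%type.

Definition rV_box n (c : 'rV[R]_n) (r : R) : set 'rV[R]_n :=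
  [set x | forall i, `|x ord0 i - c ord0 i| < r].

Lemma rV_boxE n (c : 'rV[R]_n) (r : R) :
  rV_box c r = \bigcap_(i in [set: 'I_n]) (fun x => x ord0 i) @^-1` ball (c ord0 i) r.
Proof.
apply/seteqP; split => x /= h; first by move=> i _ /=; rewrite -ball_normE/= distrC.
by move=> i; have := h i I; rewrite /= -ball_normE/= distrC.
Qed.

Lemma measurable_rV_box n (c : 'rV[R]_n) (r : R) : measurable (rV_box c r).
Proof.
rewrite rV_boxE; apply: fin_bigcap_measurable => // i _.
have := @measurable_coord _ (measurableTypeR R) n i measurableT _
  (measurable_ball (c ord0 i) r).
by rewrite setTI.
Qed.

Definition tx_box (z : tx) (r : R) : set tx := ball z.1 r `*` rV_box z.2 r.

Lemma measurable_tx_box (z : tx) (r : R) : measurable (tx_box z r).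
Proof. exact: measurableX (measurable_ball _ _) (measurable_rV_box _ _). Qed.

Lemma rV_box_mx_norm (x y : 'rV[R]_d) (r : R) : 0 < r ->
  rV_box y r x <-> `|x - y| < r.
Proof.
move=> r0; rewrite /Num.norm/= mx_normrE; split=> h.
  apply/bigmax_ltP; split=> // -[i j] _ /=.
  by rewrite !mxE (ord1 i).
move=> i; move/bigmax_ltP : h => [_ /(_ (ord0, i) isT)].
by rewrite !mxE.
Qed.

Lemma tx_boxP (z y : tx) (r : R) : 0 < r -> tx_box z r y <-> ball z r y.
Proof.
move=> r0; rewrite /tx_box -[X in _ <-> X]/(ball z.1 r y.1 /\ ball z.2 r y.2) /=.
have -> : ball z.2 r y.2 = (`|z.2 - y.2| < r) :> Prop by rewrite -ball_normE.
by rewrite distrC; split=> -[h1 h2]; split => //; exact/rV_box_mx_norm.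
Qed.

Definition rat_point (q : rat * 'rV[rat]_d) : tx :=
  (ratr q.1, \row_i ratr (q.2 ord0 i)).

Lemma rat_point_dense (z : tx) (e : R) : 0 < e -> exists q, ball z e (rat_point q).
Proof.
move=> e0.
have H (x : R) : exists q : rat, `|ratr q - x| < e.
  have : x - e < x + e by lra.
  by move=> /rat_in_itvoo[q]; rewrite in_itv/= => /andP[? ?]; exists q; rewrite ltr_norml; lra.
have [q0 hq0] := H z.1.
have /choice[q hq] : forall i : 'I_d, exists q : rat, `|ratr q - z.2 ord0 i| < e.
  by move=> i; exact: H.
exists (q0, \row_i q i); apply/tx_boxP => //; split => /=.
  by rewrite -ball_normE/= distrC.
by move=> i; rewrite !mxE.
Qed.

(** The sigma-algebra is generated by the coordinates, independently of the topology; the two are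
    linked by the countable base of boxes with rational centers and radii [1 / n.+1]. *)
Lemma open_measurable_tx (U : set (R * 'rV[R]_d)) : open U ->
  @measurable _ tx U.
Proof.
move=> oU.
(* Indices whose box is not contained in [U] contribute the empty set, so the union runs over a
   countable type. *)
pose F (p : (rat * 'rV[rat]_d) * nat) : set tx :=
  if pselect (tx_box (rat_point p.1) p.2.+1%:R^-1 `<=` U)
  then tx_box (rat_point p.1) p.2.+1%:R^-1 else set0.
have -> : U = \bigcup_p F p.
  apply/seteqP; split=> [z Uz|z [p _]]; last first.
    by rewrite /F; case: pselect => // h /h.
  have /nbhs_ballP[e /= e0 eU] := open_nbhs_nbhs (conj oU Uz).
  have [n ne] : exists n, n.+1%:R^-1 < e / 2 :> R.
    have e20 : 0 < e / 2 by rewrite divr_gt0.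
    exists (Num.trunc (e / 2)^-1).
    rewrite invf_plt ?posrE ?ltr0n//; exact: truncnS_gt.
  have n0 : (0 : R) < n.+1%:R^-1 by rewrite invr_gt0.
  have [q zq] := rat_point_dense z n0.
  exists (q, n) => //; rewrite /F /=; case: pselect => [sub|[]]; last first.
    move=> y /tx_boxP-/(_ n0) qy; apply: eU.
    apply: (@le_ball _ _ _ (n.+1%:R^-1 + n.+1%:R^-1)).
      by rewrite [leRHS]splitr lerD// ltW.
    exact: ball_triangle zq qy.
  by apply/tx_boxP => //; exact: ball_sym.
apply: countable_bigcupT_measurable => [|p]; first exact: countableP.
by rewrite /F; case: pselect => [sub|sub]; [exact: measurable_tx_box|exact: measurable0].
Qed.

Lemma continuous_measurable_tx (h : R * 'rV[R]_d -> R) : continuous h ->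
  @measurable_fun _ _ tx (measurableTypeR R) setT h.
Proof.
move=> /continuousP ch; apply: (measurability _ (RGenOpens.measurableE R)).
move=> _ [_ [a [b ->] <-]]; rewrite setTI; apply: open_measurable_tx.
exact/ch/interval_open.
Qed.

(** Induction along the recursive definition of the measure: prepending a coordinate multiplies the
    mass by the length [2 * r] of an interval, starting from mass 1 in dimension 0. *)
Lemma lebesgue_rV_box n (c : 'rV[R]_n) (r : R) : 0 < r ->
  (0 < lebesgue_rV R n (rV_box c r) < +oo)%E.
Proof.
move=> r0; elim: n c => [|n IH] c /=.
  rewrite diracE mem_set ?lte01 ?ltry//.
  by move=> [].
rewrite /lebesgue_rV_step /pushforward.
rewrite (_ : _ @^-1` _ = ball (c ord0 ord0) r `*`
    rV_box (\row_j c ord0 (lift ord0 j)) r); last first.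
  apply/seteqP; split => -[x v] /=.
    move=> h; split.
      by have := h ord0; rewrite mxE unlift_none /= -ball_normE/= distrC.
    by move=> i; have := h (lift ord0 i); rewrite !mxE liftK.
  move=> [+ h] i; rewrite -ball_normE/= mxE distrC => hx.
  by case: unliftP => [j ->|->//]; have := h j; rewrite mxE.
rewrite product_measure1E;
  [|exact: measurable_ball|exact: measurable_rV_box].
have /andP[h1 h2] := IH (\row_j c ord0 (lift ord0 j)).
rewrite [X in (X * _)%E](_ : _ = (r *+ 2)%:E);
  last exact: lebesgue_measure_ball (ltW r0).
apply/andP; split.
  by rewrite mule_gt0// lte_fin mulrn_wgt0.
by rewrite lte_mul_pinfty// ?lee_fin ?mulrn_wge0 ?(ltW r0)// fin_numE.
Qed.

Lemma lebesgue_tx_box (z : tx) (r : R) : 0 < r ->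
  (0 < lebesgue_tx R d (tx_box z r) < +oo)%E.
Proof.
move=> r0; rewrite /lebesgue_tx product_measure1E;
  [|exact: measurable_ball|exact: measurable_rV_box].
have /andP[h1 h2] := lebesgue_rV_box z.2 r0.
rewrite [X in (X * _)%E](_ : _ = (r *+ 2)%:E);
  last exact: lebesgue_measure_ball (ltW r0).
apply/andP; split.
  by rewrite mule_gt0// lte_fin mulrn_wgt0.
by rewrite lte_mul_pinfty// ?lee_fin ?mulrn_wge0 ?(ltW r0)// fin_numE.
Qed.

End tx_measure.

(** * Test functions *)

Section flat_functions.
Context {R : realType}.
Implicit Types (P : {poly R}) (x : R).

(** The polynomial factor makes the family closed under differentiation, with [dflat] acting on [P];
    smoothness of [exp (- 1 / x)] extended by 0 then follows by induction on the order. *)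
Definition flat P x : R := if 0 < x then P.[x^-1] * expR (- x^-1) else 0.

Lemma exprn_expRN_le n (y : R) : 0 <= y -> y ^+ n * expR (- y) <= n`!%:R.
Proof.
move=> y0; rewrite expRN ler_pdivrMr ?expR_gt0//.
case: n => [|n].
  by rewrite expr0 fact0 mul1r; have := expR_ge1Dx y; lra.
have := expR_ge1Dxn n y0; rewrite -(ler_pM2l (x := n.+1`!%:R)) ?ltr0n ?fact_gt0//.
by apply: le_trans; rewrite mulrDr mulrCA divff ?mulr1 ?lerDr ?ler0n// pnatr_eq0 -lt0n fact_gt0.
Qed.

Lemma flat_le_linear P : exists2 C : R, 0 <= C & forall x, `|flat P x| <= C * `|x|.
Proof.
exists (\sum_(i < size P) `|P`_i| * i.+1`!%:R).
  by apply: sumr_ge0 => i _; rewrite mulr_ge0.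
move=> x; rewrite /flat; case: ifPn => [x0|_]; last first.
  by rewrite normr0 mulr_ge0//; apply: sumr_ge0 => i _; rewrite mulr_ge0.
rewrite horner_coef mulr_suml mulr_suml; apply: le_trans (ler_norm_sum _ _ _) _.
apply: ler_sum => i _; rewrite -mulrA normrM -mulrA ler_wpM2l//.
have y0 : 0 < x^-1 by rewrite invr_gt0.
rewrite ger0_norm ?mulr_ge0 ?exprn_ge0 ?expR_ge0 ?(ltW y0)//.
rewrite gtr0_norm// -ler_pdivrMr// mulrAC -exprSr.
exact/exprn_expRN_le/ltW.
Qed.

Definition dflat P : {poly R} := 'X^2 * (P - P^`()).

Lemma is_derive_flat P x : is_derive x 1 (flat P) (flat (dflat P) x).
Proof.
have [x0|x0|->] := ltgtP x 0.
- apply: (@near_eq_is_derive _ _ _ (cst 0)).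
    by near=> y; rewrite /flat ltNge ltW//=; near: y; exact: lt_nbhsl.
  by rewrite /flat ltNge (ltW x0)/=; exact: is_derive_cst.
- apply: (@near_eq_is_derive _ _ _ (fun y : R => P.[y^-1] * expR (- y^-1))).
    by near=> y; rewrite /flat ifT//; near: y; exact: lt_nbhsr.
  have dV : is_derive x 1 (fun y : R => y^-1) (- x ^- 2).
    apply: is_derive_eq; first by apply: is_deriveV; rewrite gt_eqF.
    by rewrite scaler1.
  have dP := is_derive1_comp (is_derive_poly P x^-1) dV.
  have dN : is_derive x 1 (fun y : R => - y^-1) (- - x ^- 2) := is_deriveN dV.
  have dE := @is_derive1_comp _ expR (fun y : R => - y^-1) _ _ _ (is_derive_expR (- x^-1)) dN.
  apply: is_derive_eq (is_deriveM dP dE) _.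
  rewrite /flat x0 /dflat !hornerE /= /GRing.scale /=.
  by rewrite -exprVn; ring.
(* At the origin the difference quotient of [flat P] is [flat ('X * P)], which the linear bound
   sends to 0. *)
- rewrite /flat ltxx; have [C C0 hC] := flat_le_linear ('X * P).
  suff H : h^-1 *: (flat P (h + 0) - flat P 0) @[h --> 0^'] --> (0:R).
    apply: DeriveDef; first by apply/cvg_ex; exists 0; under eq_fun do rewrite scaler1.
    by apply/cvg_lim => //; under eq_fun do rewrite scaler1.
  have cC : C * `|h| @[h --> (0:R)^'] --> (0:R).
    rewrite -[X in _ --> X](mulr0 C); apply: cvgMr; apply: cvg_within_filter.
    by have := @norm_continuous _ R (0:R); rewrite /continuous_at normr0.
  apply: (@squeeze_cvgr _ _ _ _ (fun h => - (C * `|h|)) (fun h => C * `|h|)) => //.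
  + near=> h; rewrite -ler_norml; apply: le_trans (hC h).
    rewrite addr0 /flat ltxx subr0 /GRing.scale /=.
    by case: ifP => h0; rewrite ?mulr0// hornerM hornerX mulrA.
  + by rewrite -[X in _ --> X]oppr0; exact: cvgN.
Unshelve. all: by end_near. Qed.

Definition smooth1 (h : R -> R) : Prop := forall n x, derivable h^`(n)%classic x 1.

Lemma smooth1_derivable h x : smooth1 h -> derivable h x 1.
Proof. by move=> /(_ 0%N x). Qed.

Lemma smooth1_derive1 h : smooth1 h -> smooth1 h^`()%classic.
Proof. by move=> sh n x; rewrite -derive1Sn; exact: sh. Qed.

Lemma smooth1_flat P : smooth1 (flat P).
Proof.
suff H n : exists Q, (flat P)^`(n)%classic = flat Q.
  by move=> n x; have [Q ->] := H n; case: (is_derive_flat Q x).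
elim: n => [|n [Q HQ]]; first by exists P.
exists (dflat Q); rewrite derive1nS HQ; apply/funext => x.
by rewrite derive1E; case: (is_derive_flat Q x).
Qed.

Lemma smooth1_expR : smooth1 expR.
Proof.
suff H n : expR^`(n)%classic = expR :> (R -> R) by move=> n x; rewrite H.
elim: n => // n IH; rewrite derive1nS IH; apply/funext => x.
by rewrite derive1E derive_val.
Qed.

End flat_functions.

Section elementary.
Context {R : realType} {d : nat}.
Local Notation tx := (R * 'rV[R]_d)%type.

Definition coord_t (z : tx) : R := z.1.

Let coord_t_linear : linear coord_t.
Proof. by []. Qed.

HB.instance Definition _ := GRing.isLinear.Build R tx R _ coord_t coord_t_linear.

Lemma coord_t_continuous : continuous coord_t.
Proof. by move=> z; exact: cvg_fst. Qed.

Definition coord_x (i : 'I_d) (z : tx) : R := z.2 ord0 i.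

Let coord_x_linear i : linear (coord_x i).
Proof. by move=> a y z; rewrite /coord_x /= !mxE. Qed.

HB.instance Definition _ i := GRing.isLinear.Build R tx R _ (coord_x i)
  (coord_x_linear i).

Lemma coord_x_continuous i : continuous (coord_x i).
Proof.
move=> z; apply: (@continuous_comp _ _ _ snd (fun w : 'rV[R]_d => w ord0 i)).
  exact: cvg_snd.
exact: coord_continuous.
Qed.

(** A class of differentiable functions stable under every directional derivative. Membership
    therefore yields [smooth], which speaks of iterated derivatives, without computing any of
    them. *)
Inductive elementary : (tx -> R) -> Prop :=
| elementary_cst c : elementary (cst c)
| elementary_t : elementary coord_t
| elementary_x i : elementary (coord_x i)
| elementary_add p q : elementary p -> elementary q -> elementary (p + q)
| elementary_mul p q : elementary p -> elementary q -> elementary (p * q)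
| elementary_comp h p : smooth1 h -> elementary p -> elementary (h \o p).

Lemma elementary_differentiable p : elementary p -> forall z, differentiable p z.
Proof.
elim=> {p}.
- by move=> c z.
- by move=> z; apply: linear_differentiable; exact: coord_t_continuous.
- by move=> i z; apply: linear_differentiable; exact: coord_x_continuous.
- by move=> p q _ hp _ hq z; exact: differentiableD.
- by move=> p q _ hp _ hq z; exact: differentiableM.
- move=> h p sh _ hp z; apply: differentiable_comp => //.
  exact/derivable1_diffP/smooth1_derivable.
Qed.

Lemma derive_smooth1_comp h p z v : smooth1 h -> differentiable p z ->
  'D_v (h \o p : tx -> R) z = h^`()%classic (p z) * 'D_v p z.
Proof.
move=> sh dp; have dh : differentiable h (p z).
  exact/derivable1_diffP/smooth1_derivable.
rewrite deriveE; last exact: differentiable_comp.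
by rewrite diff_comp//= deriveE// diff1E//= mulrC.
Qed.

Lemma elementary_derive p v : elementary p -> elementary ('D_v p).
Proof.
elim=> {p}.
- move=> c; rewrite (_ : 'D_v _ = cst 0); first exact: elementary_cst.
  by apply/funext => z; rewrite derive_cst.
- rewrite (_ : 'D_v _ = cst v.1); first exact: elementary_cst.
  apply/funext => z; rewrite deriveE.
    by rewrite diff_lin//; exact: coord_t_continuous.
  by apply: elementary_differentiable; exact: elementary_t.
- move=> i; rewrite (_ : 'D_v _ = cst (v.2 ord0 i)); first exact: elementary_cst.
  apply/funext => z; rewrite deriveE.
    by rewrite diff_lin//; exact: coord_x_continuous.
  by apply: elementary_differentiable; exact: elementary_x.
- move=> p q ep hp eq hq; rewrite (_ : 'D_v _ = 'D_v p + 'D_v q).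
    exact: elementary_add.
  by apply/funext => z; rewrite deriveD//; apply: diff_derivable; exact: elementary_differentiable.
- move=> p q ep hp eq hq; rewrite (_ : 'D_v _ = p * 'D_v q + q * 'D_v p).
    by apply: elementary_add; apply: elementary_mul.
  by apply/funext => z; rewrite deriveM//; apply: diff_derivable; exact: elementary_differentiable.
- move=> h p sh ep hp; rewrite (_ : 'D_v _ = (h^`()%classic \o p) * 'D_v p).
    by apply: elementary_mul => //; apply: elementary_comp => //; exact: smooth1_derive1.
  by apply/funext => z; rewrite derive_smooth1_comp//; exact: elementary_differentiable.
Qed.

Lemma elementary_smooth p : elementary p -> smooth p.
Proof.
move=> ep s; suff : elementary (foldr (fun v h => 'D_v h) p s).
  exact: elementary_differentiable.
by elim: s => // v s; exact: elementary_derive.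
Qed.

End elementary.

Section cone.
Context {R : realType} {d : nat}.
Local Notation tx := (R * 'rV[R]_d)%type.
Implicit Types (p q : tx -> R) (z w : tx).

Definition flat1 : R -> R := flat 1.

Lemma flat1E x : flat1 x = if 0 < x then expR (- x^-1) else 0.
Proof. by rewrite /flat1 /flat hornerC mul1r. Qed.

Lemma flat1_ge0 x : 0 <= flat1 x.
Proof. by rewrite flat1E; case: ifP => // _; exact: expR_ge0. Qed.

Lemma flat1_gt0 x : 0 < x -> 0 < flat1 x.
Proof. by rewrite flat1E => ->; exact: expR_gt0. Qed.

Lemma flat1_le0 x : x <= 0 -> flat1 x = 0.
Proof. by rewrite flat1E leNgt => /negbTE ->. Qed.

Lemma flat1_lt x y : 0 < y -> x < y -> flat1 x < flat1 y.
Proof.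
move=> y0 xy; have [x0|x0] := leP x 0; first by rewrite flat1_le0// flat1_gt0.
by rewrite !flat1E x0 y0 ltr_expR ltrN2 ltf_pV2.
Qed.

Lemma flat1_le x y : x <= y -> flat1 x <= flat1 y.
Proof.
rewrite le_eqVlt => /predU1P[->//|xy].
have [y0|y0] := leP y 0; last by rewrite ltW// flat1_lt.
by rewrite !flat1_le0// (le_trans (ltW xy)).
Qed.

Lemma derive1_flat1 x : flat1^`()%classic x = if 0 < x then x^-1 ^+ 2 * expR (- x^-1) else 0.
Proof.
rewrite derive1E; have [_ ->] := is_derive_flat 1 x.
by rewrite /flat /dflat derivC subr0 mulr1 hornerXn.
Qed.

Lemma derive1_flat1_ge0 x : 0 <= flat1^`()%classic x.
Proof.
by rewrite derive1_flat1; case: ifP => // _; rewrite mulr_ge0 ?sqr_ge0 ?expR_ge0.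
Qed.

Lemma derive1_flat1_gt0 x : 0 < x -> 0 < flat1^`()%classic x.
Proof. by move=> x0; rewrite derive1_flat1 x0 mulr_gt0 ?expR_gt0 ?exprn_gt0 ?invr_gt0. Qed.

Lemma derive1_flat1_le0 x : x <= 0 -> flat1^`()%classic x = 0.
Proof. by rewrite derive1_flat1 leNgt => /negbTE ->. Qed.

Lemma smooth1_flat1 : smooth1 flat1.
Proof. exact: smooth1_flat. Qed.

Definition aff_t (a b : R) : tx -> R := cst a + cst b * coord_t.

Definition aff_x (a b c : R) (i : 'I_d) : tx -> R := aff_t a b + cst c * coord_x i.

Lemma elementary_aff_t a b : elementary (aff_t a b).
Proof.
apply: elementary_add; first exact: elementary_cst.
by apply: elementary_mul; [exact: elementary_cst|exact: elementary_t].
Qed.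

Lemma elementary_aff_x a b c i : elementary (aff_x a b c i).
Proof.
apply: elementary_add; first exact: elementary_aff_t.
by apply: elementary_mul; [exact: elementary_cst|exact: elementary_x].
Qed.

Lemma derivable_elementary p z w : elementary p -> derivable p z w.
Proof. by move=> ep; apply: diff_derivable; exact: elementary_differentiable. Qed.

Lemma derive_coord_t z w : 'D_w coord_t z = w.1.
Proof.
rewrite deriveE; first by rewrite diff_lin//; exact: coord_t_continuous.
by apply: elementary_differentiable; exact: elementary_t.
Qed.

Lemma derive_coord_x i z w : 'D_w (coord_x i) z = w.2 ord0 i.
Proof.
rewrite deriveE; first by rewrite diff_lin//; exact: coord_x_continuous.
by apply: elementary_differentiable; exact: elementary_x.
Qed.

Lemma derive_aff_t a b z w : 'D_w (aff_t a b) z = b * w.1.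
Proof.
have et := elementary_t : elementary (@coord_t R d).
have eb := elementary_cst b : elementary (cst b : tx -> R).
rewrite deriveD ?derive_cst ?add0r; [|exact: derivable_cst|].
  rewrite deriveM; try exact: derivable_elementary.
  by rewrite derive_cst derive_coord_t scaler0 addr0.
exact: derivable_elementary (elementary_mul eb et).
Qed.

Lemma derive_aff_x a b c i z w : 'D_w (aff_x a b c i) z = b * w.1 + c * w.2 ord0 i.
Proof.
have ex := elementary_x i : elementary (@coord_x R d i).
have ec := elementary_cst c : elementary (cst c : tx -> R).
rewrite deriveD ?derive_aff_t; first congr (_ + _).
- rewrite deriveM; try exact: derivable_elementary.
  by rewrite derive_cst derive_coord_x scaler0 addr0.
- exact: derivable_elementary (elementary_aff_t _ _).
- exact: derivable_elementary (elementary_mul ec ex).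
Qed.

(** A smooth transition from 0 for [y <= 0] to a positive constant for [y >= 1]. It uses only
    [flat1], sums and constants, so it stays [elementary], which the usual quotient of bump
    functions would not do directly. *)
Definition step (y : R) : R := flat1 (flat1 1 - flat1 (1 - y)).

(** Nonnegativity is included so that the property passes to products, by the Leibniz rule. *)
Definition monotone_along w p :=
  [/\ elementary p, forall z, 0 <= p z & forall z, 0 <= 'D_w p z].

Lemma monotone_along_mul w p q :
  monotone_along w p -> monotone_along w q -> monotone_along w (p * q).
Proof.
move=> [ep p0 dp] [eq q0 dq]; split.
- exact: elementary_mul.
- by move=> z; exact: mulr_ge0.
- move=> z; rewrite deriveM; try exact: derivable_elementary.
  by rewrite addr_ge0// mulr_ge0.
Qed.

Lemma monotone_along_prod w (I : finType) (F : I -> tx -> R) :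
  (forall i, monotone_along w (F i)) -> monotone_along w (\prod_i F i).
Proof.
move=> hF; elim/big_ind : _ => //; last by move=> p q; exact: monotone_along_mul.
split; first exact: elementary_cst; first by move=> z; exact: ler01.
by move=> z; rewrite [X in _ <= X](_ : _ = 0)//; exact: derive_cst.
Qed.

Lemma monotone_along_flat1 w a b c i : 0 <= b * w.1 + c * w.2 ord0 i ->
  monotone_along w (flat1 \o aff_x a b c i).
Proof.
move=> h; split.
- exact: elementary_comp smooth1_flat1 (elementary_aff_x _ _ _ _).
- by move=> z; exact: flat1_ge0.
- move=> z; rewrite derive_smooth1_comp ?derive_aff_x.
  + by rewrite mulr_ge0// derive1_flat1_ge0.
  + exact: smooth1_flat1.
  + exact: elementary_differentiable (elementary_aff_x _ _ _ _) _.
Qed.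

Definition dstep (y : R) : R :=
  flat1^`()%classic (flat1 1 - flat1 (1 - y)) * flat1^`()%classic (1 - y).

Lemma dstep_ge0 y : 0 <= dstep y.
Proof. by rewrite mulr_ge0 ?derive1_flat1_ge0. Qed.

Lemma dstep_out y : dstep y != 0 -> 0 < y < 1.
Proof.
apply: contraNT; rewrite negb_and -!leNgt => /orP[y0|y1]; rewrite /dstep.
  rewrite derive1_flat1_le0 ?mul0r//.
  by rewrite subr_le0 flat1_le// lerBrDr gerDl.
by rewrite [X in _ * X]derive1_flat1_le0 ?mulr0// subr_le0.
Qed.

Lemma dstep_gt0 y : 0 < y < 1 -> 0 < dstep y.
Proof.
move=> /andP[y0 y1]; rewrite mulr_gt0// derive1_flat1_gt0// ?subr_gt0//.
by rewrite flat1_lt// gtrBl.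
Qed.

Lemma step_ge0 y : 0 <= step y. Proof. exact: flat1_ge0. Qed.

Lemma step_le0 y : y <= 0 -> step y = 0.
Proof. by move=> y0; rewrite /step flat1_le0// subr_le0 flat1_le// lerBrDr gerDl. Qed.

Lemma step_gt0 y : 0 < y -> 0 < step y.
Proof. by move=> y0; rewrite flat1_gt0// subr_gt0 flat1_lt// gtrBl. Qed.

Lemma elementary_step p : elementary p -> elementary (step \o p).
Proof.
move=> ep.
have -> : step \o p = flat1 \o (cst (flat1 1) + cst (-1) * (flat1 \o (cst 1 + cst (-1) * p))).
  by apply/funext => z; rewrite /step /= !fctE /= !mulN1r.
do ![apply: elementary_cst|apply: elementary_add|apply: elementary_mul
    |apply: elementary_comp => //; first exact: smooth1_flat1] => //.
Qed.

Lemma derive_step p z w : elementary p ->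
  'D_w (step \o p) z = dstep (p z) * 'D_w p z.
Proof.
move=> ep.
pose p1 : tx -> R := cst 1 + cst (-1) * p.
pose p2 : tx -> R := cst (flat1 1) + cst (-1) * (flat1 \o p1).
have D1 c q y : elementary q -> elementary (cst c + cst (-1) * q : tx -> R) /\
    'D_w (cst c + cst (-1) * q : tx -> R) y = - 'D_w q y.
  move=> eq; have em : elementary (cst (-1) * q : tx -> R).
    by apply: elementary_mul => //; exact: elementary_cst.
  split; first by apply: elementary_add => //; exact: elementary_cst.
  rewrite deriveD; [|exact: derivable_cst|exact: derivable_elementary].
  rewrite derive_cst add0r deriveM; [|exact: derivable_cst|exact: derivable_elementary].
  by rewrite derive_cst scaler0 addr0 scaleN1r.
have -> : step \o p = flat1 \o p2.
  by apply/funext => y; rewrite /step /p2 /p1 /= !fctE /= !mulN1r.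
have [e1 d1] := D1 1 p z ep.
have eb1 : elementary (flat1 \o p1) by apply: elementary_comp => //; exact: smooth1_flat1.
have [e2 d2] := D1 (flat1 1) (flat1 \o p1) z eb1.
rewrite derive_smooth1_comp; [|exact: smooth1_flat1|exact: elementary_differentiable].
rewrite d2 derive_smooth1_comp; [|exact: smooth1_flat1|exact: elementary_differentiable].
by rewrite d1 !mulrN opprK mulrA /dstep /p2 /p1 /= !fctE /= !mulN1r.
Qed.

End cone.

(** * The test function on a moving and widening box *)

Section cone_test.
Context {R : realType} {d : nat}.
Local Notation tx := (R * 'rV[R]_d)%type.
Variables (t0 : R) (x0 c : 'rV[R]_d) (sg s k R0 r m : R).
Hypotheses (sg2 : sg * sg = 1) (s0 : 0 < s) (k0 : 0 <= k) (R00 : 0 < R0) (r0 : 0 < r).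
Implicit Types z w : tx.

Lemma sgP : sg = 1 \/ sg = -1.
Proof.
have : (sg - 1) * (sg + 1) == 0 by apply/eqP; have := sg2; lra.
by rewrite mulf_eq0 subr_eq0 addr_eq0 => /orP[]/eqP; [left|right].
Qed.

(* With [sg = 1] or [-1], [tau] is the time elapsed from [t0] forwards or
   backwards, and [cone] is positive where every coordinate of
   [x - x0 - (t - t0) c] is smaller than [R0 + k * tau] in absolute value. *)
Definition tau z : R := sg * (z.1 - t0).

(** For [e = 1] and [e = -1] this is the signed distance to the two faces of the moving box in
    direction [i]; [cone_lE] is the readable form, while the affine form gives the derivatives. *)
Definition cone_l (e : R) (i : 'I_d) : tx -> R :=
  aff_x (R0 - k * sg * t0 - e * (x0 ord0 i - t0 * c ord0 i)) (k * sg - e * c ord0 i) e i.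

Lemma cone_lE e i z : cone_l e i z =
  R0 + k * tau z + e * (z.2 ord0 i - x0 ord0 i - (z.1 - t0) * c ord0 i).
Proof. by rewrite /cone_l /aff_x /aff_t /tau !fctE /coord_t /coord_x; ring. Qed.

Definition cone_factor (i : 'I_d) : tx -> R :=
  (flat1 \o cone_l 1 i) * (flat1 \o cone_l (-1) i).

Definition cone : tx -> R := \prod_(i < d) cone_factor i.

(** An integrating factor: with [m = lam * G] its growth pays for the source term. *)
Definition expf : tx -> R := expR \o aff_t (- (m * sg * t0)) (m * sg).

(** The argument of [rise] goes from 0 to 1 while [tau] goes from [- r] to [r]; that of [fall] goes
    from 1 to 0 while [tau] goes from [s] to [s + r]. *)
Definition rise_arg : tx -> R := aff_t ((r - sg * t0) / (2 * r)) (sg / (2 * r)).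

Definition fall_arg : tx -> R := aff_t ((s + r + sg * t0) / r) (- sg / r).

Definition rise : tx -> R := step \o rise_arg.

Definition fall : tx -> R := step \o fall_arg.

Definition cone_test : tx -> R := expf * (rise * fall) * cone.

Lemma expfE z : expf z = expR (m * tau z).
Proof. by rewrite /expf /= /aff_t /tau !fctE /coord_t; congr expR; ring. Qed.

Lemma rise_argE z : rise_arg z = (tau z + r) / (2 * r).
Proof. by rewrite /rise_arg /aff_t /tau !fctE /coord_t; ring. Qed.

Lemma fall_argE z : fall_arg z = (s + r - tau z) / r.
Proof. by rewrite /fall_arg /aff_t /tau !fctE /coord_t; ring. Qed.

Lemma coneE z :
  cone z = \prod_(i < d) (flat1 (cone_l 1 i z) * flat1 (cone_l (-1) i z)).
Proof.
rewrite /cone; elim/big_rec2 : _ => // i p q _ <-.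
by rewrite !fctE.
Qed.

Lemma cone_ge0 z : 0 <= cone z.
Proof. by rewrite coneE prodr_ge0// => i _; rewrite mulr_ge0 ?flat1_ge0. Qed.

Lemma cone_neq0 z : cone z != 0 -> forall i,
  `|z.2 ord0 i - x0 ord0 i - (z.1 - t0) * c ord0 i| < R0 + k * tau z.
Proof.
rewrite coneE prodf_seq_neq0 => /allP h i.
have := h i (mem_index_enum _); rewrite /= mulf_eq0 negb_or => /andP[h1 h2].
have p1 : 0 < cone_l 1 i z.
  by rewrite ltNge; apply: contra h1 => /flat1_le0 ->.
have p2 : 0 < cone_l (-1) i z.
  by rewrite ltNge; apply: contra h2 => /flat1_le0 ->.
by move: p1 p2; rewrite !cone_lE ltr_norml mul1r mulN1r; lra.
Qed.

Lemma cone_gt0 : 0 < cone (t0, x0).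
Proof.
rewrite coneE prodr_gt0// => i _.
by rewrite mulr_gt0// flat1_gt0// cone_lE /tau /= !subrr !mulr0 !mul0r !subr0 mulr0 !addr0.
Qed.

Lemma elementary_cone : elementary cone.
Proof.
rewrite /cone; elim/big_ind : _ => //; first exact: elementary_cst.
  by move=> p q; exact: elementary_mul.
by move=> i _; apply: elementary_mul; apply: elementary_comp;
  (exact: smooth1_flat1 || exact: elementary_aff_x).
Qed.

Lemma elementary_rise : elementary rise.
Proof. by apply: elementary_step; exact: elementary_aff_t. Qed.

Lemma elementary_fall : elementary fall.
Proof. by apply: elementary_step; exact: elementary_aff_t. Qed.

Lemma elementary_expf : elementary expf.
Proof. by apply: elementary_comp; [exact: smooth1_expR|exact: elementary_aff_t]. Qed.

Lemma elementary_cone_test : elementary cone_test.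
Proof.
exact: elementary_mul (elementary_mul elementary_expf
  (elementary_mul elementary_rise elementary_fall)) elementary_cone.
Qed.

Lemma cone_test_ge0 z : 0 <= cone_test z.
Proof.
rewrite /cone_test !fctE expfE mulr_ge0 ?cone_ge0// mulr_ge0 ?expR_ge0//.
by rewrite mulr_ge0// step_ge0.
Qed.

Lemma cone_test_neq0 z : cone_test z != 0 ->
  - r < tau z < s + r /\ cone z != 0.
Proof.
rewrite /cone_test !fctE !mulf_eq0 !negb_or => /andP[/andP[_ /andP[h1 h2]] h3].
split=> //; apply/andP; split.
- rewrite ltNge; apply: contra h1 => h; rewrite /rise /= step_le0// rise_argE.
  by rewrite mulr_le0_ge0 ?invr_ge0 ?mulr_ge0 ?(ltW r0)//; lra.
- rewrite ltNge; apply: contra h2 => h; rewrite /fall /= step_le0// fall_argE.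
  by rewrite mulr_le0_ge0 ?invr_ge0 ?mulr_ge0 ?(ltW r0)//; lra.
Qed.

(** The contribution of the derivative of [rise] to that of the test function, without the factor
    [expf]. It is positive at [(t0, x0)], where the lower bound on [u] is known. *)
Definition gain : tx -> R := fun z => dstep (rise_arg z) / (2 * r) * fall z * cone z.

Lemma gain_ge0 z : 0 <= gain z.
Proof.
have r20 : 0 <= (2 * r)^-1 by rewrite invr_ge0 mulr_ge0 ?(ltW r0).
by rewrite /gain mulr_ge0 ?cone_ge0// mulr_ge0 ?step_ge0// mulr_ge0 ?dstep_ge0.
Qed.

Lemma gain_neq0 z : gain z != 0 -> -r < tau z < r.
Proof.
move=> g0; have /dstep_out : dstep (rise_arg z) != 0.
  by apply: contra_neq g0; rewrite /gain => ->; rewrite !mul0r.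
rewrite rise_argE ltr_pdivrMr ?ltr_pdivlMr ?mulr_gt0// => /andP[h1 h2].
by apply/andP; split; lra.
Qed.

Lemma gain_gt0 : 0 < gain (t0, x0).
Proof.
have r20 : 0 < (2 * r)^-1 by rewrite invr_gt0 mulr_gt0.
rewrite /gain mulr_gt0 ?cone_gt0// mulr_gt0//; first rewrite mulr_gt0//.
  apply: dstep_gt0; rewrite rise_argE /tau /= subrr mulr0 add0r.
  rewrite divr_gt0 ?mulr_gt0//= ltr_pdivrMr ?mulr_gt0//. by have := r0; lra.
apply: step_gt0; rewrite fall_argE /tau /= subrr mulr0 subr0.
by rewrite divr_gt0// addr_gt0.
Qed.

Lemma derive1_flat1_continuous : continuous (flat1^`()%classic : R -> R).
Proof.
move=> x; apply/differentiable_continuous/derivable1_diffP.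
by apply: smooth1_derivable; apply: smooth1_derive1; exact: smooth1_flat1.
Qed.

Lemma flat1_continuous : continuous (flat1 : R -> R).
Proof.
move=> x; apply/differentiable_continuous/derivable1_diffP.
by apply: smooth1_derivable; exact: smooth1_flat1.
Qed.

Lemma elementary_continuous (p : tx -> R) : elementary p -> continuous p.
Proof. by move=> ep z; apply/differentiable_continuous/elementary_differentiable. Qed.

Lemma dstep_continuous : continuous (dstep : R -> R).
Proof.
have c1 : continuous (fun y : R => 1 - y).
  by move=> y; apply: cvgB; [exact: cvg_cst|exact: cvg_id].
have c2 : continuous (flat1 \o (fun y : R => 1 - y)).
  by move=> y; apply: continuous_comp; [exact: c1|exact: flat1_continuous].
have c3 : continuous (fun y : R => flat1 1 - flat1 (1 - y)).
  by move=> y; apply: cvgB; [exact: cvg_cst|exact: c2].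
have c4 : continuous (flat1^`()%classic \o (fun y : R => flat1 1 - flat1 (1 - y))).
  by move=> y; apply: continuous_comp; [exact: c3|exact: derive1_flat1_continuous].
have c5 : continuous (flat1^`()%classic \o (fun y : R => 1 - y)).
  by move=> y; apply: continuous_comp; [exact: c1|exact: derive1_flat1_continuous].
by move=> y; apply: cvgM; [exact: c4|exact: c5].
Qed.

Lemma gain_continuous : continuous gain.
Proof.
have cr := elementary_continuous (elementary_aff_t ((r - sg * t0) / (2 * r)) (sg / (2 * r))).
have c1 : continuous (dstep \o rise_arg).
  by move=> z; apply: continuous_comp; [exact: cr|exact: dstep_continuous].
move=> z; apply: cvgM; last exact: elementary_continuous elementary_cone _.
apply: cvgM; last exact: elementary_continuous elementary_fall _.
by apply: cvgMl; exact: c1.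
Qed.

(** Along a velocity [y] within [k] of [c] the box widens at least as fast as the point drifts, so
    the derivative of [cone] is nonnegative and is dropped. The three remaining terms come from
    [expf], [rise] and [fall]. *)
Lemma derive_cone_test_ge (y : 'rV[R]_d) z :
  (forall i, `|y ord0 i - c ord0 i| <= k) ->
  'D_((sg, sg *: y) : tx) cone_test z >= m * cone_test z + expf z * gain z
    - expf z * rise z * (dstep (fall_arg z) / r) * cone z.
Proof.
move=> yc; set w : tx := (sg, sg *: y).
(* The derivative of [cone_l e i] along [w] is [k + e * sg * (y_i - c_i)], which is nonnegative by
   [yc]. *)
have [_ _ dcone] : monotone_along w cone.
  apply: monotone_along_prod => i; apply: monotone_along_mul; apply: monotone_along_flat1.
    by rewrite /= mxE; move: (yc i); rewrite ler_norml; case: sgP => ->; lra.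
  by rewrite /= mxE; move: (yc i); rewrite ler_norml; case: sgP => ->; lra.
have eR := elementary_rise; have eF := elementary_fall.
have eE := elementary_expf; have eC := elementary_cone.
have eRF := elementary_mul eR eF; have eERF := elementary_mul eE eRF.
rewrite /cone_test deriveM; try exact: derivable_elementary.
rewrite deriveM; try exact: derivable_elementary.
rewrite deriveM; try exact: derivable_elementary.
have -> : 'D_w expf z = m * expf z.
  rewrite derive_smooth1_comp; [|exact: smooth1_expR|].
    rewrite derive1E derive_val derive_aff_t /w /= -[m * sg * sg]mulrA sg2 mulr1.
    by rewrite mulrC.
  by apply: elementary_differentiable; exact: elementary_aff_t.
have -> : 'D_w rise z = dstep (rise_arg z) / (2 * r).
  rewrite derive_step ?derive_aff_t /w /=; last exact: elementary_aff_t.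
  by rewrite [sg / _ * _]mulrAC sg2 mul1r.
have -> : 'D_w fall z = - (dstep (fall_arg z) / r).
  rewrite derive_step ?derive_aff_t /w /=; last exact: elementary_aff_t.
  by rewrite [- sg / _ * _]mulrAC mulNr sg2 mulN1r mulrN.
rewrite !fctE /gain /GRing.scale /=.
set DF := dstep (fall_arg z) / r; set DR := dstep (rise_arg z) / (2 * r).
set Dc := 'D_w cone z.
have h : 0 <= expf z * (rise z * fall z) * Dc.
  rewrite mulr_ge0 ?dcone// mulr_ge0 ?expfE ?expR_ge0//.
  by rewrite mulr_ge0 ?step_ge0.
rewrite -subr_ge0; apply: le_trans h _; rewrite le_eqVlt; apply/orP; left; apply/eqP.
ring.
Qed.

End cone_test.

(** * Functions vanishing outside a box: bounds and integrability *)

Section box_supported.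
Context {R : realType} {d : nat}.
Local Notation tx := (R * 'rV[R]_d)%type.
Local Notation mtx := (measurableTypeR R * 'rV[R]_d)%type.
Local Notation mu := (lebesgue_tx R d).
Implicit Types (p h : tx -> R) (z : tx).

Definition supported (z0 : tx) (rho : R) p : Prop :=
  forall z, p z != 0 -> tx_box z0 rho z.

Definition closed_box (z0 : tx) (rho : R) : set tx :=
  `[z0.1 - rho, z0.1 + rho]%classic `*`
  [set x : 'rV[R]_d | forall i, `[z0.2 ord0 i - rho, z0.2 ord0 i + rho]%classic (x ord0 i)].

Lemma closed_box_compact z0 rho : compact (closed_box z0 rho).
Proof.
apply: compact_setX; first exact: segment_compact.
apply: (rV_compact (A := fun i => `[z0.2 ord0 i - rho, z0.2 ord0 i + rho]%classic)).
by move=> i; exact: segment_compact.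
Qed.

Lemma tx_box_closed_box z0 rho : (tx_box z0 rho : set tx) `<=` closed_box z0 rho.
Proof.
move=> z [/= h1 h2]; split => /=.
  by move: h1; rewrite -ball_normE/= in_itv/= ltr_norml => /andP[? ?]; apply/andP; split; lra.
by move=> i; have := h2 i; rewrite in_itv/= ltr_norml => /andP[? ?]; apply/andP; split; lra.
Qed.

Lemma supported_compact z0 rho p : supported z0 rho p ->
  compact (closure [set z | p z != 0]).
Proof.
move=> sp; apply: (@subclosed_compact _ _ (closed_box z0 rho)).
- exact: closed_closure.
- exact: closed_box_compact.
- rewrite [X in _ `<=` X](_ : _ = closure (closed_box z0 rho)).
    by apply: closure_subset => z /sp; exact: tx_box_closed_box.
  apply/closure_id; apply: compact_closed; last exact: closed_box_compact.
  exact: norm_hausdorff.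
Qed.

(** Widening the box by 1 gives every point outside it a whole neighborhood on which [p]
    vanishes. *)
Lemma supported_derive z0 rho p v : supported z0 rho p ->
  supported z0 (rho + 1) ('D_v p).
Proof.
move=> sp z; apply: contraNP => zout; apply/eqP.
rewrite -(derive_cst (0 : R) z v); apply: near_eq_derive.
near=> y; apply/eqP; apply: contra_notT zout => /sp[y1 y2].
have zy : ball z 1 y by near: y; apply: nbhsx_ballx.
have [/= z1 z2] := (tx_boxP z y (ltr01)).2 zy.
split => /=.
  by apply: ball_triangle y1 _; exact: ball_sym.
move=> i; have := y2 i; have := z2 i; rewrite !ltr_norml => /andP[? ?] /andP[? ?].
by apply/andP; split; lra.
Unshelve. all: by end_near. Qed.

Lemma supported_bounded z0 rho p : supported z0 rho p -> continuous p ->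
  exists2 C, 0 <= C & forall z, `|p z| <= C.
Proof.
move=> sp cp.
have /compact_bounded [M [_ /(_ (`|M| + 1)) HM]] : compact (p @` closed_box z0 rho).
  apply: continuous_compact; last exact: closed_box_compact.
  exact: continuous_subspaceT.
exists (`|M| + 1) => [|z]; first by rewrite addr_ge0.
have [->|pz] := eqVneq (p z) 0; first by rewrite normr0 addr_ge0.
apply: HM; first by rewrite (le_lt_trans (ler_norm M))// ltrDl.
by exists z => //; apply: tx_box_closed_box; exact: sp.
Qed.

Lemma supported_integrable z0 rho p C : 0 < rho -> supported z0 rho p ->
  (forall z, `|p z| <= C) -> measurable_fun [set: mtx] p ->
  mu.-integrable [set: mtx] (EFin \o p).
Proof.
move=> rho0 sp pC mp.
have mB := measurable_tx_box z0 rho.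
have /andP[_ Boo] := lebesgue_tx_box z0 rho0.
have iB : mu.-integrable (tx_box z0 rho : set mtx) (EFin \o p).
  apply: measurable_bounded_integrable => //.
    exact: measurable_funS mp.
  by exists C; split; [exact: num_real|move=> M CM z _; exact: le_trans (pC z) (ltW CM)].
rewrite (_ : EFin \o p = (EFin \o p) \_ (tx_box z0 rho)); first by apply/(integrable_mkcond _ mB).
apply/funext => z; rewrite patchE.
case: ifPn => // zB; apply/eqP; rewrite /= eqe.
by apply: contraNT zB => /sp; rewrite inE.
Qed.

End box_supported.

(** * Entropies and fluxes on the unit interval *)

Section unit_interval_calculus.
Context {R : realType}.
Local Notation I01 := (`[0, 1]%classic : set R).

Lemma rV_cvgP (T : Type) (F : set_system T) (FF : Filter F) d (h : T -> 'rV[R]_d) (l : 'rV[R]_d) :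
  (forall i, h x ord0 i @[x --> F] --> l ord0 i) <-> h x @[x --> F] --> l.
Proof.
split=> [H A [P MP sPA]|H i].
  have : \forall x \near F, forall i, P ord0 i (h x ord0 i).
    by apply: filter_forall => i; exact: (H i _ (MP ord0 i)).
  by apply: filterS => x Px; apply: sPA => i j; rewrite (ord1 i).
exact: (cvg_comp _ _ H (@coord_continuous R 1 d ord0 i l)).
Qed.

(** Properness makes limits unique, so that [derive_in] can be computed, also at the endpoints.
    Points are approached from the right when [v < 1] and from the left when [v] is the right
    endpoint. *)
Lemma within_dnbhs_proper (v : R) : I01 v -> ProperFilter (within I01 v^').
Proof.
rewrite /= in_itv/= => /andP[v0 v1]; split; last exact: within_filter.
rewrite /within => /nbhs_ballP[e /= e0 he].
have [v_lt1|v_ge1] := ltP v 1.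
  pose w := v + Num.min (e / 2) (1 - v).
  have m0 : 0 < Num.min (e / 2) (1 - v) by rewrite lt_min divr_gt0//= subr_gt0.
  apply: (he w).
  - rewrite -ball_normE/= /w opprD addNKr normrN gtr0_norm//.
    by rewrite gt_min; apply/orP; left; rewrite ltr_pdivrMr//; lra.
  - by rewrite /w -subr_eq0 addrAC subrr add0r gt_eqF.
  - rewrite in_itv/= /w; have hm : Num.min (e / 2) (1 - v) <= 1 - v by rewrite ge_min lexx orbT.
    by apply/andP; split; lra.
pose w := v - Num.min (e / 2) v.
have m0 : 0 < Num.min (e / 2) v by rewrite lt_min divr_gt0//=; lra.
apply: (he w).
- rewrite -ball_normE/= /w opprB addrC subrK gtr0_norm//.
  by rewrite gt_min; apply/orP; left; rewrite ltr_pdivrMr//; lra.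
- by rewrite /w -subr_eq0 addrAC subrr add0r oppr_eq0 gt_eqF.
- rewrite in_itv/= /w; have hm : Num.min (e / 2) v <= v by rewrite ge_min lexx orbT.
  by apply/andP; split; lra.
Qed.

Lemma is_derive_cvg (h : R -> R) (v D : R) : is_derive v 1 h D ->
  (w - v)^-1 *: (h w - h v) @[w --> v^'] --> D.
Proof.
move=> /is_derive1_caratheodory[g [hg cg <-]].
apply: cvg_trans (cvg_within_filter _ cg); apply: near_eq_cvg.
near=> w; rewrite hg /GRing.scale /= mulrCA mulVf ?mulr1// subr_eq0.
by near: w; exact: nbhs_dnbhs_neq.
Unshelve. all: by end_near. Qed.

Lemma is_derive_in (h : R -> R) (v D : R) : I01 v -> is_derive v 1 h D ->
  derivable_in I01 h v /\ derive_in I01 h v = D.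
Proof.
move=> Iv /is_derive_cvg H.
have PF := within_dnbhs_proper Iv.
have H' : (w - v)^-1 *: (h w - h v) @[w --> within I01 v^'] --> D.
  exact: cvg_within_filter.
split; last by rewrite /derive_in; exact: (cvg_lim (@norm_hausdorff _ _) H').
by apply/cvg_ex; exists D.
Qed.

Lemma is_derive_in_rV d (h : R -> 'rV[R]_d) (v : R) (D : 'rV[R]_d) : I01 v ->
  (forall i, is_derive v 1 (fun w => h w ord0 i) (D ord0 i)) ->
  derivable_in I01 h v /\ derive_in I01 h v = D.
Proof.
move=> Iv H.
have PF := within_dnbhs_proper Iv.
have H' : (w - v)^-1 *: (h w - h v) @[w --> within I01 v^'] --> D.
  apply/rV_cvgP => i; under eq_fun do rewrite !mxE.
  exact: cvg_within_filter (is_derive_cvg (H i)).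
split; last by rewrite /derive_in; exact: (cvg_lim (@norm_hausdorff _ _) H').
by apply/cvg_ex; exists D.
Qed.

Lemma derivable_in_coord d (h : R -> 'rV[R]_d) v i : I01 v -> derivable_in I01 h v ->
  derivable_in I01 (fun w => h w ord0 i) v /\
  derive_in I01 (fun w => h w ord0 i) v = derive_in I01 h v ord0 i.
Proof.
move=> Iv /cvg_ex[D hD]; have PF := within_dnbhs_proper Iv.
have -> : derive_in I01 h v = D by rewrite /derive_in; exact: (cvg_lim (@norm_hausdorff _ _) hD).
have hDi : (w - v)^-1 *: (h w ord0 i - h v ord0 i) @[w --> within I01 v^'] --> D ord0 i.
  by have /rV_cvgP-/(_ i) := hD; under eq_fun do rewrite !mxE.
split; last by rewrite /derive_in; exact: (cvg_lim (@norm_hausdorff _ _) hDi).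
by apply/cvg_ex; exists (D ord0 i).
Qed.

Lemma derivable_in_continuous (h : R -> R) :
  {in I01, forall v, derivable_in I01 h v} -> {within I01, continuous h}.
Proof.
move=> dh; apply/subspace_continuousP => v Iv.
have /cvg_ex[D hD] := dh v (mem_set Iv).
have H : h w @[w --> within I01 v^'] --> h v.
  have cv0 : w - v @[w --> v^'] --> (0 : R).
    have : w - v @[w --> v^'] --> v - v by apply: cvgB; [exact: nbhs_dnbhs|exact: cvg_cst].
    by rewrite subrr.
  have : (w - v) * ((w - v)^-1 *: (h w - h v)) + h v @[w --> within I01 v^'] --> 0 * D + h v.
    apply: cvgD; last exact: cvg_cst.
    apply: cvgM => //; apply: cvg_within_filter.
    exact: cv0.
  rewrite mul0r add0r; apply: cvg_trans; apply: near_eq_cvg.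
  rewrite near_withinE; near=> w => Iw.
  rewrite /GRing.scale /= mulrA divff ?mul1r ?subrK// subr_eq0.
  by near: w; exact: nbhs_dnbhs_neq.
move=> A hA; have Av := nbhs_singleton hA.
have HA : nbhs v (fun w => w != v -> I01 w -> A (h w)) by exact: H A hA.
change (nbhs v (fun w => I01 w -> A (h w))).
by apply: filterS HA => w hw Iw; have [->//|wv] := eqVneq w v; exact: hw.
Unshelve. all: by end_near. Qed.

Lemma derivable_in_interior (h : R -> R) v : v \in `]0, 1[ ->
  derivable_in I01 h v -> is_derive v 1 h (derive_in I01 h v).
Proof.
move=> Iv /cvg_ex[D hD].
have Ivc : I01 v by apply: subset_itv_oo_cc.
have PF := within_dnbhs_proper Ivc.
have -> : derive_in I01 h v = D by rewrite /derive_in; exact: (cvg_lim (@norm_hausdorff _ _) hD).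
have hD' : (w - v)^-1 *: (h w - h v) @[w --> v^'] --> D.
  move=> A hA.
  have HA : nbhs v (fun w => w != v -> I01 w -> A ((w - v)^-1 *: (h w - h v))) := hD A hA.
  have HI : nbhs v I01.
    by apply: filterS (near_in_itvoo Iv) => w; exact: subset_itv_oo_cc.
  change (nbhs v (fun w => w != v -> A ((w - v)^-1 *: (h w - h v)))).
  by apply: filterS2 HA HI => w hw Iw wv; exact: hw.
apply/is_derive1_caratheodory.
exists (fun w => if w == v then D else (w - v)^-1 *: (h w - h v)); split.
- move=> z; have [->|zv] := eqVneq z v; first by rewrite !subrr mulr0.
  by rewrite /GRing.scale /= mulrAC mulVf ?mul1r// subr_eq0.
- move=> A; rewrite eqxx => hA.
  have HA : nbhs v (fun w => w != v -> A ((w - v)^-1 *: (h w - h v))) := hD' A hA.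
  change (nbhs v (fun w => A (if w == v then D else (w - v)^-1 *: (h w - h v)))).
  by apply: filterS HA => w hw; case: ifPn => // _; exact: nbhs_singleton hA.
- by rewrite eqxx.
Qed.

Lemma derivable_in_lipschitz (h : R -> R) (M : R) :
  {in I01, forall v, derivable_in I01 h v} ->
  (forall v, I01 v -> `|derive_in I01 h v| <= M) ->
  forall x y, I01 x -> I01 y -> `|h x - h y| <= M * `|x - y|.
Proof.
move=> dh hM x y.
wlog xy : x y / x < y => [H Ix Iy|].
  have [xy|xy|->] := ltgtP x y; first exact: H.
    by rewrite distrC (distrC x); exact: H.
  by rewrite !subrr !normr0 mulr0.
move=> Ix Iy.
have sub : {subset `[x, y] <= `[0, 1] :> interval R}.
  move: Ix Iy => /=; rewrite !in_itv/= => /andP[x0 _] /andP[_ y1] z.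
  by rewrite !in_itv/= => /andP[? ?]; apply/andP; split; lra.
have suboo : {subset `]x, y[ <= `]0, 1[ :> interval R}.
  move: Ix Iy => /=; rewrite !in_itv/= => /andP[x0 _] /andP[_ y1] z.
  by rewrite !in_itv/= => /andP[? ?]; apply/andP; split; lra.
have [c cxy hc] : exists2 c, c \in `]x, y[ & h y - h x = derive_in I01 h c * (y - x).
  apply: MVT => //.
    move=> z /suboo zI; apply: derivable_in_interior => //; apply: dh.
    by apply/mem_set; exact: subset_itv_oo_cc.
  by apply: continuous_subspaceW (derivable_in_continuous dh) => z /= /sub.
rewrite distrC hc normrM (distrC x) ler_wpM2r//; apply: hM.
by apply: subset_itv_oo_cc; exact: suboo.
Qed.

End unit_interval_calculus.

Lemma continuous_sumr (R : realType) (T : topologicalType) (I : Type) (r : seq I)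
    (H : I -> T -> R) : (forall i, continuous (H i)) ->
  continuous (fun t => \sum_(i <- r) H i t).
Proof.
move=> cH; elim: r => [|i r IH].
  rewrite (_ : (fun t => _) = cst 0); last by apply/funext => t; rewrite big_nil.
  by move=> t; exact: cvg_cst.
rewrite (_ : (fun t => _) = fun t => H i t + \sum_(j <- r) H j t).
  by move=> t; apply: cvgD; [exact: cH|exact: IH].
by apply/funext => t; rewrite big_cons.
Qed.

(** * Primitives as entropies *)

Section primitive.
Context {R : realType}.
Implicit Types (h : R -> R).
Local Notation leb := (@lebesgue_measure R).

(** The base point will be taken negative, so that all of [[0, 1]] lies strictly to its right and
    the fundamental theorem gives a two-sided derivative even at 0. *)
Definition prim (b0 : R) h (w : R) : R := \int[leb]_(t in `[b0, w]) h t.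

Lemma continuous_integrable_itv h (a b : R) : continuous h ->
  leb.-integrable `[a, b] (EFin \o h).
Proof.
move=> ch; apply: continuous_compact_integrable; first exact: segment_compact.
exact: continuous_subspaceT.
Qed.

Lemma is_derive_prim b0 h (w : R) : b0 < w -> continuous h ->
  is_derive w 1 (prim b0 h) (h w).
Proof.
move=> bw ch.
have ww : w < w + 1 by rewrite ltrDl.
have [dF F'] := continuous_FTC1_closed ww (continuous_integrable_itv b0 (w + 1) ch) bw (ch w).
by apply: DeriveDef; [exact: dF|rewrite -derive1E].
Qed.

Lemma primD b0 h1 h2 w : continuous h1 -> continuous h2 ->
  prim b0 (fun t => h1 t + h2 t) w = prim b0 h1 w + prim b0 h2 w.
Proof.
by move=> c1 c2; rewrite /prim RintegralD//; exact: continuous_integrable_itv.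
Qed.

Lemma primB b0 h1 h2 w : continuous h1 -> continuous h2 ->
  prim b0 (fun t => h1 t - h2 t) w = prim b0 h1 w - prim b0 h2 w.
Proof.
by move=> c1 c2; rewrite /prim RintegralB//; exact: continuous_integrable_itv.
Qed.

Lemma primZ b0 h (k : R) w : continuous h ->
  prim b0 (fun t => k * h t) w = k * prim b0 h w.
Proof. by move=> c1; rewrite /prim RintegralZl//; exact: continuous_integrable_itv. Qed.

Lemma prim_sum b0 (I : Type) (r : seq I) (H : I -> R -> R) w :
  (forall i, continuous (H i)) ->
  prim b0 (fun t => \sum_(i <- r) H i t) w = \sum_(i <- r) prim b0 (H i) w.
Proof.
move=> cH; elim: r => [|i r IH].
  rewrite big_nil (_ : (fun t => _) = cst 0); last by apply/funext => t; rewrite big_nil.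
  by rewrite /prim Rintegral_cst// mul0r.
rewrite big_cons -IH (_ : (fun t => _) = fun t => H i t + \sum_(j <- r) H j t).
  apply: primD; first exact: cH.
  exact: continuous_sumr.
by apply/funext => t; rewrite big_cons.
Qed.

Lemma prim_le b0 h1 h2 w : continuous h1 -> continuous h2 ->
  (forall t, b0 <= t <= w -> h1 t <= h2 t) -> prim b0 h1 w <= prim b0 h2 w.
Proof.
by move=> c1 c2 h12; apply: le_Rintegral => //; exact: continuous_integrable_itv.
Qed.

Lemma prim_eq0 b0 h w : (forall t, b0 <= t <= w -> h t = 0) -> prim b0 h w = 0.
Proof.
move=> h0; rewrite /prim (@eq_Rintegral _ _ _ _ _ (cst 0)).
  by rewrite Rintegral_cst// mul0r.
by move=> t; rewrite inE/= in_itv/= => /h0.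
Qed.

Lemma prim_continuous_at b0 h w : b0 < w -> continuous h -> {for w, continuous (prim b0 h)}.
Proof.
move=> bw ch; apply/differentiable_continuous/derivable1_diffP.
by case: (is_derive_prim bw ch).
Qed.

Lemma prim_MVT b0 h x y : b0 < x -> x < y -> continuous h ->
  exists2 c, x < c < y & prim b0 h y - prim b0 h x = h c * (y - x).
Proof.
move=> bx xy ch.
have [c cxy hc] : exists2 c, c \in `]x, y[ & prim b0 h y - prim b0 h x = h c * (y - x).
  apply: MVT => //.
    by move=> z; rewrite in_itv/= => /andP[xz _]; apply: is_derive_prim => //; exact: lt_trans xz.
  apply: continuous_in_subspaceT => z; rewrite inE/= in_itv/= => /andP[xz _].
  by apply: prim_continuous_at => //; exact: lt_le_trans xz.
by exists c => //; move: cxy; rewrite in_itv.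
Qed.

Lemma prim_nondecreasing b0 h x y : b0 < x -> x <= y -> continuous h ->
  (forall t, 0 <= h t) -> prim b0 h x <= prim b0 h y.
Proof.
move=> bx; rewrite le_eqVlt => /predU1P[->//|xy] ch h0.
have [c _ hc] := prim_MVT bx xy ch.
by rewrite -subr_ge0 hc mulr_ge0// subr_ge0 ltW.
Qed.

Lemma prim_tangent b0 h x y : b0 < x -> b0 < y -> continuous h ->
  {homo h : s t / s <= t} -> h x * (y - x) <= prim b0 h y - prim b0 h x.
Proof.
move=> bx bw ch hh; have [xy|yx|->] := ltgtP x y; last by rewrite !subrr mulr0.
- have [c /andP[xc _] ->] := prim_MVT bx xy ch.
  by rewrite ler_wpM2r ?subr_ge0 ?(ltW xy)// hh// ltW.
- have [c /andP[_ cx] hc] := prim_MVT bw yx ch.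
  rewrite -[leRHS]opprB hc -[y - x]opprB mulrN lerN2.
  by rewrite ler_wpM2r ?subr_ge0 ?(ltW yx)// hh// ltW.
Qed.

Lemma prim_convex b0 h : b0 < 0 -> continuous h -> {homo h : s t / s <= t} ->
  convex_function (`[0, 1]%classic : set R) (prim b0 h).
Proof.
move=> b00 ch hh t x y; rewrite !inE /= !in_itv/= => /andP[x0 _] /andP[y0 _].
rewrite [X in _ <= X]convRE [X in prim _ _ X]convRE.
set p := t%:num; set z : R := p * x + _.
have p0 : 0 <= p by rewrite /p.
have q0 : 0 <= unstable.onem p by rewrite /unstable.onem subr_ge0 /p.
have z0 : 0 <= z by rewrite /z addr_ge0// mulr_ge0.
have bz : b0 < z by exact: lt_le_trans z0.
have bx : b0 < x by exact: lt_le_trans x0.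
have bw : b0 < y by exact: lt_le_trans y0.
(* Both inequalities use the tangent at the convex combination [z]; in their weighted sum the linear
   terms cancel. *)
have h1 := ler_wpM2l p0 (prim_tangent bz bx ch hh).
have h2 := ler_wpM2l q0 (prim_tangent bz bw ch hh).
have := lerD h1 h2.
have -> : p * (h z * (x - z)) + unstable.onem p * (h z * (y - z)) = 0.
  have -> : z = p * x + (1 - p) * y by [].
  by rewrite /unstable.onem; move: (h _) => k; ring.
by move: (prim b0 h) => F; rewrite /unstable.onem; lra.
Qed.

End primitive.

Section flux_speed.
Context {R : realType} {d : nat}.
Local Notation I01 := (`[0, 1]%classic : set R).

Definition clamp01 (w : R) : R := Num.max 0 (Num.min w 1).

Lemma clamp01_in w : I01 (clamp01 w).
Proof.
by rewrite /= in_itv/= /clamp01 le_max lexx/= ge_max ler01/= ge_min lexx orbT.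
Qed.

Lemma clamp01_id w : w \in `[0, 1] -> clamp01 w = w.
Proof. by rewrite in_itv/= /clamp01 => /andP[w0 w1]; rewrite (min_idPl w1) (max_idPr w0). Qed.

Lemma clamp01_lipschitz w w' : `|clamp01 w - clamp01 w'| <= `|w - w'|.
Proof.
have P x : [\/ x <= 0 /\ clamp01 x = 0, 0 <= x <= 1 /\ clamp01 x = x
    | 1 <= x /\ clamp01 x = 1].
  have [x0|x0] := leP x 0.
    constructor 1; split => //; rewrite /clamp01.
    by rewrite (min_idPl _) ?(max_idPl _)// (le_trans x0).
  have [x1|x1] := leP x 1.
    constructor 2; split; first (by apply/andP; split; lra); rewrite /clamp01.
    by rewrite (min_idPl _)// (max_idPr _)// ltW.
  constructor 3; split; first exact: ltW; rewrite /clamp01.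
  by rewrite (min_idPr (ltW x1)) (max_idPr _).
by have [[hw ->]|[/andP[hw1 hw2] ->]|[hw ->]] := P w;
  have [[hw' ->]|[/andP[hw1' hw2'] ->]|[hw' ->]] := P w';
  rewrite ler_norml; case: (ler0P (w - w')) => h; apply/andP; split; lra.
Qed.

(** Constant extension of [f'] beyond the unit interval. It is globally Lipschitz, which allows
    primitives based at a negative point and lower bounds whose value has dropped below 0. *)
Definition speed (f : R -> 'rV[R]_d) (w : R) : 'rV[R]_d := derive_in I01 f (clamp01 w).

Lemma speed_lipschitz (f : R -> 'rV[R]_d) : C2_in I01 f ->
  exists2 L, 0 < L & forall w w' i, `|speed f w ord0 i - speed f w' ord0 i| <= L * `|w - w'|.
Proof.
move=> [df ddf cddf].
have /compact_bounded [M [_ /(_ (`|M| + 1)) HM]] :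
    compact (derive_in I01 (derive_in I01 f) @` I01).
  by apply: continuous_compact; [exact: cddf|exact: segment_compact].
exists (`|M| + 1) => [|w w' i]; first by rewrite ltr_pwDr.
apply: le_trans (_ : (`|M| + 1) * `|clamp01 w - clamp01 w'| <= _); last first.
  by rewrite ler_wpM2l ?clamp01_lipschitz// addr_ge0.
apply: (@derivable_in_lipschitz _ (fun v => derive_in I01 f v ord0 i)); last 2 first.
- exact: clamp01_in.
- exact: clamp01_in.
- by move=> v Iv; have [] := derivable_in_coord i (set_mem Iv) (ddf v Iv).
- move=> v Iv; have [_ ->] := derivable_in_coord i Iv (ddf v (mem_set Iv)).
  have : `|derive_in I01 (derive_in I01 f) v| <= `|M| + 1.
    apply: HM; first by rewrite (le_lt_trans (ler_norm M))// ltrDl.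
    by exists v.
  rewrite /Num.norm /= mx_normrE => /bigmax_leP[_ h].
  exact: (h (ord0, i)).
Qed.

Lemma speed_continuous (f : R -> 'rV[R]_d) i : C2_in I01 f ->
  continuous (fun w => speed f w ord0 i).
Proof.
move=> /speed_lipschitz[L L0 HL] w; apply/cvgrPdist_le => e e0.
have eL : 0 < L^-1 * e by rewrite mulr_gt0 ?invr_gt0.
near=> w'; apply: (le_trans (HL _ _ _)); rewrite -ler_pdivlMl// ltW//.
Unshelve. all: by end_near. Qed.

Definition prim_flux (b0 : R) (f : R -> 'rV[R]_d) (rho : R -> R) (w : R) : 'rV[R]_d :=
  \row_i prim b0 (fun t => rho t * speed f t ord0 i) w.

Lemma prim_entropy_flux_pair (b0 : R) f rho : b0 < 0 -> C2_in I01 f -> continuous rho ->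
  {homo rho : s t / s <= t} -> entropy_flux_pair f (prim b0 rho) (prim_flux b0 f rho).
Proof.
move=> b00 fC2 cr hr; split; first exact: prim_convex.
move=> v vI.
have bv : b0 < v by move: vI; rewrite in_itv/= => /andP[v0 _]; exact: lt_le_trans v0.
have [d1 e1] := is_derive_in vI (is_derive_prim bv cr).
have Hq i : is_derive v 1 (fun w => prim_flux b0 f rho w ord0 i)
    ((rho v *: speed f v) ord0 i).
  rewrite (_ : (fun w => _) = prim b0 (fun t => rho t * speed f t ord0 i)).
    rewrite mxE; apply: (is_derive_prim bv) => w.
    by apply: cvgM; [exact: cr|exact: speed_continuous].
  by apply/funext => w; rewrite mxE.
have [d2 e2] := is_derive_in_rV vI Hq.
by split; [exact: d1|exact: d2|rewrite e1 e2 /speed (clamp01_id vI)].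
Qed.

Lemma derive_in_prim (b0 : R) rho v : b0 < 0 -> v \in `[0, 1] -> continuous rho ->
  derive_in I01 (prim b0 rho) v = rho v.
Proof.
move=> b00 vI cr.
have bv : b0 < v by move: vI; rewrite in_itv/= => /andP[v0 _]; exact: lt_le_trans v0.
by have [_ ->] := is_derive_in vI (is_derive_prim bv cr).
Qed.

End flux_speed.

(** * The entropy balance for differences of convex entropies *)

Section weak_formulation.
Context {R : realType} {d : nat}.
Local Notation tx := (R * 'rV[R]_d)%type.
Local Notation mtx := (measurableTypeR R * 'rV[R]_d)%type.
Local Notation mu := (lebesgue_tx R d).
Local Notation I01 := (`[0, 1]%classic : set R).

Lemma Lfun_oo_bounded (g : tx -> R) : g \in Lfun mu +oo%E ->
  exists G, exists g' : mtx -> R, [/\ 0 < G, measurable_fun setT g',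
    forall z, `|g' z| <= G & \forall z \ae mu, g z = g' z].
Proof.
move=> gL.
have mg : measurable_fun [set: mtx] g by have := set_mem (sub_Lfun_mfun gL).
have : ('N[ mu ]_+oo [ EFin \o g ] < +oo)%E by have := set_mem (sub_Lfun_finLfun gL).
(* The supremum norm is defined by cases on whether the whole space has positive measure; a unit box
   shows that it has. *)
rewrite unlock /Lnorm ifT; last first.
  have /andP[B0 _] := lebesgue_tx_box ((0, 0) : mtx) ltr01.
  apply: lt_le_trans B0 _; apply: le_measure => //; rewrite inE //.
  exact: measurable_tx_box.
move=> Hess.
have [M HM] : exists M, \forall z \ae mu, `|g z| <= M.
  have := @ess_supr_bounded _ mtx R mu (Num.norm \o g); apply; exact: Hess.
pose G := `|M| + 1; have G0 : 0 < G by rewrite /G ltr_pwDr.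
exists G, (fun z => Num.max (- G) (Num.min (g z) G)); split => //.
- apply: measurable_maxr => //.
  exact: measurable_minr.
- move=> z; rewrite ler_norml le_max lexx/= ge_max ge_min lexx orbT andbT; lra.
- have FA : Filter (almost_everywhere mu) by exact: ae_filter_ringOfSetsType.
  apply: filterS HM => z gM.
  have : `|g z| <= G by rewrite (le_trans gM)// /G (le_trans (ler_norm _))// lerDl.
  by rewrite ler_norml => /andP[h1 h2]; rewrite (min_idPl h2) (max_idPr h1).
Qed.

Variables (f : R -> 'rV[R]_d) (g g' u : tx -> R) (G : R).
Hypotheses (fC2 : C2_in I01 f) (mg : measurable_fun [set: mtx] g)
  (mg' : measurable_fun [set: mtx] g')
  (g'G : forall z, `|g' z| <= G) (gg' : \forall z \ae mu, g z = g' z)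
  (u_cont : continuous u) (u_01 : forall z, u z \in `[0, 1])
  (u_isentropic : isentropic f g u).

(** The left-hand integrand of the weak form for the entropy with derivative [rho]. Time and space
    parts stay together because they are later read as one directional derivative of [phi] for each
    value. *)
Definition entropy_production (b0 : R) (rho : R -> R) (phi : tx -> R) (z : tx) : R :=
  prim b0 rho (u z) * partial_t phi z
  + \sum_(i < d) prim_flux b0 f rho (u z) ord0 i * partial_x i phi z.

Definition entropy_source (rho : R -> R) (phi : tx -> R) (z : tx) : R :=
  rho (u z) * g' z * phi z.

Variables (b0 : R) (phi : tx -> R) (z0 : tx) (r : R).
Hypotheses (b00 : b0 < 0) (ephi : elementary phi) (r0 : 0 < r) (sphi : supported z0 r phi).

Let bu z : b0 < u z.
Proof. by have := u_01 z; rewrite in_itv/= => /andP[+ _]; exact: lt_le_trans. Qed.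

Lemma entropy_production_integrable (rho : R -> R) : continuous rho ->
  mu.-integrable setT (EFin \o entropy_production b0 rho phi).
Proof.
move=> cr.
have cp h : continuous h -> continuous (prim b0 h \o u).
  by move=> ch z; apply: continuous_comp; [exact: u_cont|exact: prim_continuous_at].
have cA : continuous (entropy_production b0 rho phi).
  move=> z; apply: cvgD.
    apply: cvgM; first exact: cp.
    exact: (elementary_continuous (elementary_derive _ ephi)).
  apply: (@continuous_sumr R _ _ _
    (fun i z => prim_flux b0 f rho (u z) ord0 i * partial_x i phi z)) => i {}z.
  apply: cvgM; last exact: (elementary_continuous (elementary_derive _ ephi)).
  rewrite /prim_flux; under eq_fun do rewrite mxE; rewrite mxE.
  apply: (cp (fun t => rho t * speed f t ord0 i)) => w.
  by apply: cvgM; [exact: cr|exact: speed_continuous].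
have sA : supported z0 (r + 1) (entropy_production b0 rho phi).
  move=> z; apply: contraNP => zout.
  have D0 v : 'D_v phi z = 0.
    by apply/eqP; apply: contra_notT zout; exact: supported_derive.
  rewrite /entropy_production /partial_t /partial_x D0 mulr0 add0r.
  by rewrite big1// => i _; rewrite D0 mulr0.
have [C _ AC] := supported_bounded sA cA.
have r1 : 0 < r + 1 by rewrite addr_gt0.
by apply: (supported_integrable r1 sA AC); exact: continuous_measurable_tx.
Qed.

Lemma measurable_entropy_source (rho : R -> R) (h : tx -> R) : continuous rho ->
  measurable_fun [set: mtx] h ->
  measurable_fun [set: mtx] (fun z => rho (u z) * h z * phi z).
Proof.
move=> cr mh; apply: measurable_funM; last first.
  exact: continuous_measurable_tx (elementary_continuous ephi).
apply: measurable_funM => //.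
apply: (@continuous_measurable_tx _ _ (rho \o u)) => z.
by apply: continuous_comp; [exact: u_cont|exact: cr].
Qed.

Lemma entropy_source_integrable (rho : R -> R) : continuous rho ->
  mu.-integrable setT (EFin \o entropy_source rho phi).
Proof.
move=> cr.
have c1 : continuous (fun z => rho (u z) * phi z).
  move=> z; apply: cvgM; last exact: elementary_continuous.
  by apply: (@continuous_comp _ _ _ u rho); [exact: u_cont|exact: cr].
have s1 : supported z0 r (fun z => rho (u z) * phi z).
  by move=> z; rewrite mulf_eq0 negb_or => /andP[_ /sphi].
have [C C0 HC] := supported_bounded s1 c1.
apply: (@supported_integrable R d z0 r _ (G * C)) => //.
- by move=> z; rewrite mulf_eq0 negb_or => /andP[_ /sphi].
- by move=> z; rewrite /entropy_source mulrAC mulrC normrM ler_pM.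
- exact: measurable_entropy_source.
Qed.

Lemma entropy_balance_homo (rho : R -> R) : continuous rho -> {homo rho : s t / s <= t} ->
  \int[mu]_z entropy_production b0 rho phi z + \int[mu]_z entropy_source rho phi z = 0.
Proof.
move=> cr hr.
have tphi : test_function phi.
  by split; [exact: elementary_smooth|exact: supported_compact sphi].
have := u_isentropic (prim_entropy_flux_pair b00 fC2 cr hr) tphi.
have -> : \int[mu]_z (derive_in I01 (prim b0 rho) (u z) * g z * phi z) =
    \int[mu]_z entropy_source rho phi z.
  rewrite /Rintegral; congr fine.
  under eq_integral => z _ do rewrite derive_in_prim//.
  apply: ae_eq_integral => //.
  - by apply/measurable_EFinP; exact: measurable_entropy_source.
  - by apply/measurable_EFinP; exact: measurable_entropy_source.
  - have FA : Filter (almost_everywhere mu) by exact: ae_filter_ringOfSetsType.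
    by apply: filterS gg' => z /= -> _.
by rewrite /entropy_production => <-; rewrite subrr.
Qed.

(** Both sides of the balance are linear in [rho], so the difference of two monotone derivatives
    inherits it. This is what permits an entropy whose derivative vanishes outside a value interval.
    Integrability is what allows the integrals to be split. *)
Lemma entropy_balance (rho1 rho2 : R -> R) :
  continuous rho1 -> {homo rho1 : s t / s <= t} ->
  continuous rho2 -> {homo rho2 : s t / s <= t} ->
  let rho t := rho1 t - rho2 t in
  \int[mu]_z (entropy_production b0 rho phi z + entropy_source rho phi z) = 0.
Proof.
move=> c1 h1 c2 h2 rho.
have cr : continuous rho by move=> w; apply: cvgB; [exact: c1|exact: c2].
have P1 := entropy_production_integrable c1.
have P2 := entropy_production_integrable c2.
have S1 := entropy_source_integrable c1.
have S2 := entropy_source_integrable c2.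
rewrite RintegralD//; last 2 first.
- exact: entropy_production_integrable.
- exact: entropy_source_integrable.
have -> : \int[mu]_z entropy_production b0 rho phi z =
    \int[mu]_z (entropy_production b0 rho1 phi z - entropy_production b0 rho2 phi z).
  apply: eq_Rintegral => z _; rewrite /entropy_production primB// opprD addrACA.
  congr (_ + _); first by rewrite mulrBl.
  rewrite -sumrB; apply: eq_bigr => i _; rewrite -mulrBl /prim_flux !mxE -primB//; first last.
  - by move=> w; apply: cvgM; [exact: c2|exact: speed_continuous].
  - by move=> w; apply: cvgM; [exact: c1|exact: speed_continuous].
  by congr (_ * _); congr prim; apply/funext => t; rewrite mulrBl.
have -> : \int[mu]_z entropy_source rho phi z =
    \int[mu]_z (entropy_source rho1 phi z - entropy_source rho2 phi z).
  by apply: eq_Rintegral => z _; rewrite /entropy_source /rho; ring.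
rewrite !RintegralB// addrACA -opprD.
by rewrite (entropy_balance_homo c1 h1) (entropy_balance_homo c2 h2) subrr.
Qed.

End weak_formulation.

(** * Propagation of lower bounds *)

Section truncated_exponential.
Context {R : realType}.

Definition ramp (x y w : R) : R := Num.max 0 (Num.min (w - x) (y - x)).

Lemma ramp_continuous x y : continuous (ramp x y).
Proof.
move=> w; apply: (@continuous_max _ _ (cst 0) (fun w => Num.min (w - x) (y - x))).
  exact: cvg_cst.
apply: (@continuous_min _ _ (fun w => w - x) (cst (y - x))); last exact: cvg_cst.
by apply: cvgB; [exact: cvg_id|exact: cvg_cst].
Qed.

Lemma ramp_homo x y : {homo ramp x y : s t / s <= t}.
Proof.
move=> s t st; rewrite /ramp ge_max le_max lexx/= le_max; apply/orP; right.
by rewrite le_min !ge_min lerD2r st /= lexx orbT.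
Qed.

Lemma ramp_ge0 x y w : 0 <= ramp x y w.
Proof. by rewrite /ramp le_max lexx. Qed.

Lemma ramp_le x y w : w <= x -> ramp x y w = 0.
Proof. by move=> wx; apply/max_idPl; rewrite ge_min subr_le0 wx. Qed.

Lemma ramp_in x y w : x <= w <= y -> ramp x y w = w - x.
Proof.
by move=> /andP[xw wy]; rewrite /ramp (min_idPl _) ?lerD2r// (max_idPr _)// subr_ge0.
Qed.

Lemma ramp_ge x y w : x <= y -> y <= w -> ramp x y w = y - x.
Proof.
by move=> xy yw; rewrite /ramp (min_idPr _) ?lerD2r// (max_idPr _)// subr_ge0.
Qed.

Variables (a b v lam b0 : R).
Hypotheses (ab : a < b) (bv : b < v) (lam0 : 0 < lam) (b0a : b0 < a).

(* [trunc_rho] is continuous, supported in [[a, v]], equal to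
   [lam * (exp (lam * (w - a)) - 1)] on [[a, b]], and a difference of
   nondecreasing functions, so that its primitive is a difference of convex
   entropies. *)
Definition rise_rho (w : R) : R := lam * (expR (lam * ramp a b w) - 1).

Definition fall_rho (w : R) : R := rise_rho b / (v - b) * ramp b v w.

Definition trunc_rho (w : R) : R := rise_rho w - fall_rho w.

Lemma rise_rho_continuous : continuous rise_rho.
Proof.
move=> w; apply: cvgMr; apply: cvgB; last exact: cvg_cst.
apply: (@continuous_comp _ _ _ (fun w => lam * ramp a b w) expR).
  by apply: cvgMr; exact: ramp_continuous.
exact: continuous_expR.
Qed.

Lemma rise_rho_homo : {homo rise_rho : s t / s <= t}.
Proof.
move=> s t st; rewrite ler_pM2l// lerD2r ler_expR ler_pM2l//.
exact: ramp_homo.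
Qed.

Lemma rise_rho_ge0 w : 0 <= rise_rho w.
Proof.
rewrite mulr_ge0 ?(ltW lam0)// subr_ge0 -expR0 ler_expR mulr_ge0 ?ramp_ge0//.
exact: ltW.
Qed.

Lemma fall_rho_continuous : continuous fall_rho.
Proof. by move=> w; apply: cvgMr; exact: ramp_continuous. Qed.

Let slope_ge0 : 0 <= rise_rho b / (v - b).
Proof. by rewrite divr_ge0 ?rise_rho_ge0// subr_ge0 ltW. Qed.

Lemma fall_rho_homo : {homo fall_rho : s t / s <= t}.
Proof. by move=> s t st; rewrite ler_wpM2l//; exact: ramp_homo. Qed.

Lemma fall_rho_ge0 w : 0 <= fall_rho w.
Proof. by rewrite mulr_ge0// ramp_ge0. Qed.

Lemma rise_rho_ge w : b <= w -> rise_rho w = rise_rho b.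
Proof. by move=> bw; rewrite /rise_rho !ramp_ge// ltW. Qed.

Lemma trunc_rho_le w : w <= a -> trunc_rho w = 0.
Proof.
move=> wa; rewrite /trunc_rho /rise_rho /fall_rho (ramp_le _ wa) mulr0 expR0 subrr mulr0.
by rewrite ramp_le ?mulr0 ?subrr// (le_trans wa)// ltW.
Qed.

Lemma trunc_rho_ge w : v <= w -> trunc_rho w = 0.
Proof.
move=> vw; rewrite /trunc_rho rise_rho_ge; last by rewrite (le_trans _ vw)// ltW.
rewrite /fall_rho ramp_ge ?(ltW bv)// divfK ?subrr//.
by rewrite subr_eq0 gt_eqF.
Qed.

Lemma trunc_rho_in w : w <= b -> trunc_rho w = rise_rho w.
Proof. by move=> wb; rewrite /trunc_rho /fall_rho ramp_le// mulr0 subr0. Qed.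

Lemma trunc_rho_ge0 w : 0 <= trunc_rho w.
Proof.
have [wb|bw] := leP w b; first by rewrite trunc_rho_in// rise_rho_ge0.
have [vw|wv] := leP v w; first by rewrite trunc_rho_ge.
rewrite /trunc_rho rise_rho_ge ?(ltW bw)// subr_ge0 /fall_rho mulrAC.
rewrite ler_pdivrMr ?subr_gt0// ler_wpM2l ?rise_rho_ge0//.
by rewrite ramp_in ?(ltW bw) ?(ltW wv)// lerD2r ltW.
Qed.

Lemma trunc_rho_le_rise w : trunc_rho w <= rise_rho w.
Proof. by rewrite lerBlDr lerDl fall_rho_ge0. Qed.

Lemma trunc_rho_continuous : continuous trunc_rho.
Proof. by move=> w; apply: cvgB; [exact: rise_rho_continuous|exact: fall_rho_continuous]. Qed.

Local Notation eta := (prim b0 trunc_rho).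

Lemma eta_le w : w <= a -> eta w = 0.
Proof. by move=> wa; apply: prim_eq0 => t /andP[_ tw]; rewrite trunc_rho_le// (le_trans tw). Qed.

Lemma eta_homo x y : a <= x -> x <= y -> eta x <= eta y.
Proof.
move=> ax xy; apply: prim_nondecreasing => //; first exact: lt_le_trans ax.
  exact: trunc_rho_continuous.
exact: trunc_rho_ge0.
Qed.

Lemma eta_ge0 w : 0 <= eta w.
Proof.
have [wa|aw] := leP w a; first by rewrite eta_le.
by rewrite -(eta_le (lexx a)) eta_homo// ltW.
Qed.

Lemma eta_in w : a <= w <= b -> eta w = expR (lam * (w - a)) - 1 - lam * (w - a).
Proof.
move=> /andP[]; rewrite le_eqVlt => /predU1P[<- _|aw wb].
  by rewrite eta_le// subrr mulr0 expR0 !subrr.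
pose E (t : R) := expR (lam * (t - a)) - 1 - lam * (t - a).
have dE (t : R) : is_derive t 1 E (lam * (expR (lam * (t - a)) - 1)).
  have dl : is_derive t 1 (fun t : R => lam * (t - a)) lam.
    have dB : is_derive t 1 (fun t : R => t - a) (1 - 0).
      exact: (is_deriveB (is_derive_id _ _) (is_derive_cst _ _ _)).
    by apply: is_derive_eq (is_deriveZ lam dB) _; rewrite subr0 /GRing.scale /= mulr1.
  have dX := is_derive1_comp (is_derive_expR _) dl.
  have d1 := is_deriveB dX (is_derive_cst (1 : R) t (1 : R)).
  by apply: is_derive_eq (is_deriveB d1 dl) _; rewrite subr0; ring.
have dF t : a < t -> is_derive t 1 eta (trunc_rho t).
  by move=> t_a; apply: is_derive_prim; [exact: lt_trans t_a|exact: trunc_rho_continuous].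
(* Both functions have derivative [rise_rho] on this interval and vanish at [a]. *)
have [c cin hc] : exists2 c, c \in `]a, w[ & (eta - E) w - (eta - E) a = cst 0 c * (w - a).
  apply: MVT => //.
  - move=> t; rewrite in_itv/= => /andP[t_a tw].
    apply: is_derive_eq (is_deriveB (dF t t_a) (dE t)) _.
    rewrite trunc_rho_in; last by rewrite (le_trans (ltW tw)).
    by rewrite /rise_rho ramp_in ?(ltW t_a) ?(le_trans (ltW tw))// subrr.
  - apply: continuous_in_subspaceT => t; rewrite inE/= in_itv/= => /andP[t_a _].
    apply: cvgB.
      by apply: prim_continuous_at; [exact: lt_le_trans t_a|exact: trunc_rho_continuous].
    by apply/differentiable_continuous/derivable1_diffP; case: (dE t).
move: hc; rewrite /= !fctE mul0r (eta_le (lexx a)) /E subrr mulr0 expR0 !subrr.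
by rewrite subr0 => /eqP; rewrite subr_eq0 => /eqP.
Qed.

(* A source bounded by [G] makes the integral of the entropy decay at most at
   the exponential rate [lam * G], up to an error negligible against [eta b]. *)
Lemma trunc_rho_le_eta w : trunc_rho w <= lam * eta w + lam ^+ 2 * (b - a).
Proof.
have e0 : 0 <= lam ^+ 2 * (b - a) by rewrite mulr_ge0 ?sqr_ge0// subr_ge0 ltW.
have [wa|aw] := leP w a; first by rewrite trunc_rho_le// eta_le// mulr0 add0r.
(* On [[a, b]] the explicit formula gives equality with [w' - a] in place of [b - a]. Beyond [b],
   [trunc_rho] stays below [rise_rho b] while [eta] does not decrease. *)
have H w' : a <= w' <= b -> rise_rho w' <= lam * eta w' + lam ^+ 2 * (b - a).
  move=> /[dup] /andP[aw' wb'] w'I; rewrite eta_in// /rise_rho ramp_in//.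
  apply: le_trans (_ : lam * (expR (lam * (w' - a)) - 1 - lam * (w' - a)) +
    lam ^+ 2 * (w' - a) <= _); first by rewrite le_eqVlt; apply/orP; left; apply/eqP; ring.
  by rewrite lerD2l ler_wpM2l ?sqr_ge0// lerD2r.
have [wb|bw] := leP w b; first by rewrite trunc_rho_in// H// (ltW aw).
apply: le_trans (trunc_rho_le_rise _) _; rewrite rise_rho_ge ?(ltW bw)//.
apply: le_trans (H b _) _; first by rewrite lexx ltW.
by rewrite lerD2r ler_pM2l// eta_homo// ltW.
Qed.

Lemma eta_ge w : b <= w -> expR (lam * (b - a)) - 1 - lam * (b - a) <= eta w.
Proof.
by move=> bw; rewrite -eta_in ?lexx ?(ltW ab)// eta_homo// ltW.
Qed.

End truncated_exponential.

(** Used with [A = b - a], the available drop in value, and [B = G * (s + 2 * r)], the drop that the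
    source can cause. *)
Lemma exp_dominates (R : realType) (A B c C : R) : B < A -> 0 < A -> 0 < c -> 0 <= C ->
  exists2 lam, 0 < lam &
    C * lam ^+ 2 * expR (lam * B) < c * (expR (lam * A) - 1 - lam * A).
Proof.
move=> BA A0 c0 C0; set D := A - B; have D0 : 0 < D by rewrite subr_gt0.
(* The first term lets the cubic term of [expR (lam * D)] absorb [2 * C * lam ^+ 2]; the second
   gives [5 <= lam * A], so that [1 + lam * A] takes at most half of [expR (lam * A)]. *)
pose lam := 12 * C / (c * D ^+ 3) + 5 / A.
have l1 : 0 <= 12 * C / (c * D ^+ 3).
  by rewrite divr_ge0 ?mulr_ge0 ?exprn_ge0 ?(ltW c0) ?(ltW D0).
have l2 : 0 < 5 / A by rewrite divr_gt0.
have lam0 : 0 < lam by rewrite /lam; lra.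
exists lam => //.
have h1 : 5 <= lam * A by rewrite -ler_pdivrMr// /lam; lra.
have h2 := expR_ge1Dxn 1 (ltW (mulr_gt0 lam0 A0)).
have h3 : expR (lam * A) <= 2 * (expR (lam * A) - 1 - lam * A).
  move: h1 h2; rewrite (_ : 2`! = 2)//; move: (lam * A) => x h1; move: (expR x) => E h2.
  have : x ^+ 2 >= 5 * x by rewrite expr2; nra.
  by lra.
have h4 := expR_ge1Dxn 2 (ltW (mulr_gt0 lam0 D0)).
have h5 : 2 * C * lam ^+ 2 < c * expR (lam * D).
  have h6 : 12 * C <= lam * (c * D ^+ 3).
    by rewrite -ler_pdivrMr ?mulr_gt0 ?exprn_gt0// /lam; lra.
  apply: lt_le_trans (_ : c * (1 + (lam * D) ^+ 3 / 3`!%:R) <= _); last by rewrite ler_pM2l.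
  rewrite (_ : 3`! = 6)// mulrDr mulr1.
  have h7 : 12 * C * lam ^+ 2 <= lam * (c * D ^+ 3) * lam ^+ 2.
    by rewrite ler_wpM2r ?sqr_ge0.
  have -> : c * ((lam * D) ^+ 3 / 6%:R) = lam * (c * D ^+ 3) * lam ^+ 2 / 6 by ring.
  by move: (lam * _ * _) h7 => y; lra.
have eB := expR_gt0 (lam * B).
have h6 : 2 * C * lam ^+ 2 * expR (lam * B) < c * expR (lam * A).
  have -> : lam * A = lam * D + lam * B by rewrite /D; ring.
  by rewrite expRD mulrA ltr_pM2r.
have h7 := ler_wpM2l (ltW c0) h3.
by move: h6 h7; move: (expR (lam * A)) (expR (lam * B)) => EA EB; lra.
Qed.

Section propagation.
Context {R : realType} {d : nat}.
Local Notation tx := (R * 'rV[R]_d)%type.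
Local Notation mtx := (measurableTypeR R * 'rV[R]_d)%type.
Local Notation mu := (lebesgue_tx R d).
Local Notation I01 := (`[0, 1]%classic : set R).

Lemma derive_direction (phi : tx -> R) (z : tx) (sg : R) (y : 'rV[R]_d) :
  differentiable phi z ->
  'D_((sg, sg *: y) : tx) phi z =
  sg * (partial_t phi z + \sum_(i < d) y ord0 i * partial_x i phi z).
Proof.
move=> dphi; rewrite /partial_t /partial_x !deriveE//.
under eq_bigr do rewrite deriveE//.
have -> : ((sg, sg *: y) : tx) =
    sg *: (((1, 0) : tx) + \sum_(i < d) y ord0 i *: ((0, delta_mx ord0 i) : tx)).
  have -> : \sum_(i < d) y ord0 i *: ((0, delta_mx ord0 i) : tx) = (0, y).
    rewrite [in RHS](row_sum_delta y).
    elim/big_rec2 : _ => // i a b _ ->.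
    apply/pair_equal_spec; split => //=; first by rewrite scaler0 add0r.
  by congr pair; rewrite /= ?addr0 ?add0r /GRing.scale /= ?mulr1.
rewrite linearZ linearD linear_sum /=; congr (_ * (_ + _)).
by apply: eq_bigr => i _; rewrite linearZ.
Qed.

(** The radius is fixed before [m], so the mass of the supporting box does not change as [lam]
    grows. It adds the drift of the center, at most [(s + r) * S], to the width of the box. *)
Lemma supported_cone_test (t0 : R) (x0 c : 'rV[R]_d) (sg s k R0 r : R) :
  sg * sg = 1 -> 0 < s -> 0 <= k -> 0 < R0 -> 0 < r ->
  exists2 rho, 0 < rho & forall m,
  supported ((t0, x0) : tx) rho (cone_test t0 x0 c sg s k R0 r m).
Proof.
move=> sg2 s0 k0 R00 r0.
pose S := \sum_(j < d) `|c ord0 j|.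
have S0 : 0 <= S by apply: sumr_ge0.
have cS i : `|c ord0 i| <= S by rewrite /S (bigD1 i)//= lerDl sumr_ge0.
have sr : 0 < s + r by rewrite addr_gt0.
exists ((s + r) + R0 + k * (s + r) + (s + r) * S).
  by rewrite ltr_pwDl ?mulr_ge0 ?(ltW sr)// ltr_pwDl ?mulr_ge0 ?(ltW sr)// addr_gt0.
move=> m z /(cone_test_neq0 r0)[/andP[t1 t2] hc].
have kt : k * tau t0 sg z <= k * (s + r) by rewrite ler_wpM2l// ltW.
have ht : `|z.1 - t0| < s + r.
  have : `|tau t0 sg z| < s + r by rewrite ltr_norml; apply/andP; split => //; lra.
  by rewrite /tau; case: (sgP sg2) => ->; rewrite ?mulN1r ?normrN ?mul1r.
have kS : 0 <= k * (s + r) by rewrite mulr_ge0// ltW.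
have sS : 0 <= (s + r) * S by rewrite mulr_ge0// ltW.
split => /=; first by rewrite -ball_normE/= distrC; lra.
move=> i; have h1 := cone_neq0 hc i.
have h2 : `|(z.1 - t0) * c ord0 i| <= (s + r) * S.
  by rewrite normrM ler_pM// ltW.
have -> : z.2 ord0 i - x0 ord0 i =
  (z.2 ord0 i - x0 ord0 i - (z.1 - t0) * c ord0 i) + (z.1 - t0) * c ord0 i by rewrite subrK.
apply: le_lt_trans (ler_normD _ _) _; lra.
Qed.

Variables (f : R -> 'rV[R]_d) (g g' u : tx -> R) (G L : R).
Hypotheses (fC2 : C2_in I01 f) (mg : measurable_fun [set: mtx] g)
  (mg' : measurable_fun [set: mtx] g') (G0 : 0 < G) (L0 : 0 < L)
  (g'G : forall z, `|g' z| <= G) (gg' : \forall z \ae mu, g z = g' z)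
  (u_cont : continuous u) (u_01 : forall z, u z \in `[0, 1])
  (u_isentropic : isentropic f g u)
  (speedL : forall w w' i, `|speed f w ord0 i - speed f w' ord0 i| <= L * `|w - w'|).

Section core.
Variables (t0 : R) (x0 : 'rV[R]_d) (sg s R0 r a b v : R).
Hypotheses (sg2 : sg * sg = 1) (s0 : 0 < s) (R00 : 0 < R0) (r0 : 0 < r)
  (ab : a < b) (bv : b < v).
Let k := L * (v - a).
Let c := speed f v.
Local Notation tau := (tau t0 sg).
Local Notation cone := (cone t0 x0 c sg k R0).
Local Notation test := (cone_test t0 x0 c sg s k R0 r).
Local Notation gain := (gain t0 x0 c sg s k R0 r).
Hypothesis Hfall : forall z, s < tau z < s + r -> cone z != 0 -> u z <= a.

Let av : a < v. Proof. exact: lt_trans ab bv. Qed.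
Let k0 : 0 <= k. Proof. by rewrite mulr_ge0 ?(ltW L0)// subr_ge0 ltW. Qed.

(** The growth of [expf] cancels the main part [lam * eta] of the source estimate, and the loss from
    [fall] disappears by [Hfall]; only the gain and a remainder quadratic in [lam] survive. *)
Lemma pointwise_lower_bound (lam b0 : R) z : 0 < lam -> b0 < 0 -> b0 < a ->
  prim b0 (trunc_rho a b v lam) (u z) * (expR (lam * G * tau z) * gain z) -
    G * (lam ^+ 2 * (b - a)) * test (lam * G) z
  <= sg * (entropy_production f u b0 (trunc_rho a b v lam) (test (lam * G)) z
           + entropy_source g' u (trunc_rho a b v lam) (test (lam * G)) z).
Proof.
move=> lam0 b00 b0a; set rho := trunc_rho a b v lam; set m := lam * G.
have cr : continuous rho by exact: trunc_rho_continuous.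
have etest := elementary_cone_test t0 x0 c sg s k R0 r m.
have dtest := elementary_differentiable etest z.
pose D (t : R) := 'D_((sg, sg *: speed f t) : tx) (test m) z.
have DE t : D t = sg * (partial_t (test m) z
    + \sum_(i < d) speed f t ord0 i * partial_x i (test m) z).
  exact: derive_direction.
have cD : continuous D.
  rewrite (_ : D = fun t => sg * (partial_t (test m) z
    + \sum_(i < d) speed f t ord0 i * partial_x i (test m) z)); last exact/funext.
  move=> t; apply: cvgMr; apply: cvgD; first exact: cvg_cst.
  apply: (@continuous_sumr R R _ _ (fun i t => speed f t ord0 i * partial_x i (test m) z)).
  by move=> i {}t; apply: cvgMl; exact: speed_continuous.
(* Entropy and flux are merged into a single integral over values [t], in which the test function is
   differentiated along the velocity [speed f t]. *)
have prodE : sg * entropy_production f u b0 rho (test m) z =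
    prim b0 (fun t => rho t * D t) (u z).
  have cs i : continuous (fun t => rho t * speed f t ord0 i).
    by move=> t; apply: cvgM; [exact: cr|exact: speed_continuous].
  rewrite (_ : (fun t => rho t * D t) = fun t => sg * partial_t (test m) z * rho t +
      \sum_(i < d) sg * partial_x i (test m) z * (rho t * speed f t ord0 i)); last first.
    apply/funext => t; rewrite DE mulrDr mulrDr !mulr_sumr; congr (_ + _); first by ring.
    by apply: eq_bigr => i _; ring.
  rewrite primD; last 2 first.
  - by move=> t; apply: cvgMr; exact: cr.
  - apply: (@continuous_sumr R R _ _ (fun i t =>
      sg * partial_x i (test m) z * (rho t * speed f t ord0 i))) => i t.
    by apply: cvgMr; exact: cs.
  rewrite primZ// (prim_sum _ _ (H := fun i t =>
      sg * partial_x i (test m) z * (rho t * speed f t ord0 i))); last first.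
    by move=> i t; apply: cvgMr; exact: cs.
  rewrite /entropy_production mulrDr mulr_sumr; congr (_ + _); first by ring.
  by apply: eq_bigr => i _; rewrite primZ// /prim_flux mxE; ring.
set E := prim b0 rho (u z).
pose K := expR (m * tau z) * rise t0 sg r z * (dstep (fall_arg t0 sg s r z) / r) * cone z.
have lowD : (m * test m z + expR (m * tau z) * gain z - K) * E <=
    prim b0 (fun t => rho t * D t) (u z).
  rewrite -primZ//; apply: prim_le.
  - by move=> t; apply: cvgMr; exact: cr.
  - by move=> t; apply: cvgM; [exact: cr|exact: cD].
  - move=> t _; rewrite mulrC.
    have [ta|at_] := leP t a; first by rewrite /rho trunc_rho_le// !mul0r.
    have [vt|tv] := leP v t; first by rewrite /rho trunc_rho_ge// !mul0r.
    rewrite ler_wpM2l ?trunc_rho_ge0//.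
    rewrite /K /D -(expfE t0 sg m z); apply: derive_cone_test_ge => // i.
    apply: le_trans (speedL _ _ _) _.
    rewrite /k ler_wpM2l ?(ltW L0)// ler_norml; apply/andP; split; lra.
(* [fall] varies only for [s < tau < s + r]; there [u <= a] inside the box, where the entropy
   vanishes. *)
have KE : K * E = 0.
  have [->|K0] := eqVneq K 0; first by rewrite mul0r.
  suff uza : u z <= a by rewrite /E eta_le// mulr0.
  apply: Hfall.
    have : dstep (fall_arg t0 sg s r z) != 0.
      by apply: contra_neq K0; rewrite /K => ->; rewrite mul0r mulr0 mul0r.
    move/dstep_out; rewrite fall_argE// => /andP[].
    rewrite ltr_pdivrMr// ltr_pdivlMr// => h1 h2; apply/andP; split; lra.
  by apply: contra_neq K0; rewrite /K => ->; rewrite mulr0.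
have rhoE : rho (u z) <= lam * E + lam ^+ 2 * (b - a) by exact: trunc_rho_le_eta.
have test0 : 0 <= test m z by exact: cone_test_ge0.
have rho0 : 0 <= rho (u z) by exact: trunc_rho_ge0.
have srcE : - (G * ((lam * E + lam ^+ 2 * (b - a)) * test m z)) <=
    sg * entropy_source g' u rho (test m) z.
  have h1 : `|sg * entropy_source g' u rho (test m) z| <= G * (rho (u z) * test m z).
    rewrite /entropy_source normrM (_ : `|sg| = 1); last first.
      by case: (sgP sg2) => ->; rewrite ?normrN normr1.
    rewrite mul1r (normrM (rho _ * _)) (normrM (rho _)) (ger0_norm test0) (ger0_norm rho0).
    by rewrite mulrA [G * _]mulrC ler_wpM2r// ler_wpM2l.
  have h2 : G * (rho (u z) * test m z) <= G * ((lam * E + lam ^+ 2 * (b - a)) * test m z).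
    by rewrite ler_wpM2l ?(ltW G0)// ler_wpM2r.
  by move: h1; rewrite ler_norml => /andP[h1 _]; apply: le_trans h1; rewrite lerN2.
rewrite [leRHS]mulrDr prodE; apply: le_trans (lerD lowD srcE).
rewrite le_eqVlt; apply/orP; left; apply/eqP.
rewrite (_ : (m * test m z + expR (m * tau z) * gain z - K) * E =
  (m * test m z + expR (m * tau z) * gain z) * E - K * E); last by ring.
by rewrite KE /m; ring.
Qed.

Hypotheses (start : b < u (t0, x0)) (short : G * (s + 2 * r) < b - a).

(* As [lam] grows, the gain on a fixed neighborhood of [(t0, x0)], of order
   [exp (lam * (b - a))], exceeds the loss [exp (lam * G * (s + 2 * r))]. *)
Lemma no_fall : False.
Proof.
have [rho rho0 srho] := supported_cone_test t0 x0 c sg2 s0 k0 R00 r0.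
pose z0 : tx := (t0, x0).
have gz0 : 0 < gain z0 by exact: gain_gt0.
pose c0 := gain z0 / 2; have c00 : 0 < c0 by rewrite divr_gt0.
have [nr /= nr0 hN] : exists2 nr : R, 0 < nr & ball z0 nr `<=` [set z | c0 <= gain z /\ b <= u z].
  apply/nbhs_ballP.
  have h1 : \forall z \near z0, c0 < gain z.
    have cg : continuous gain by exact: gain_continuous.
    have /cvgr_gt := (cg : continuous gain) z0; apply.
    by rewrite /c0 ltr_pdivrMr// ltr_pMr// ltr1n.
  have h2 : \forall z \near z0, b < u z by have /cvgr_gt := (u_cont : continuous u) z0; exact.
  by apply: filterS2 h1 h2 => z /ltW ? /ltW.
have [M M0 HM] : exists2 M, 0 <= M & forall z, `|test 0 z| <= M.
  apply: supported_bounded (srho 0) _; apply: elementary_continuous.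
  exact: elementary_cone_test.
have /andP[muN0 muNoo] := lebesgue_tx_box z0 nr0.
have /andP[muK0 muKoo] := lebesgue_tx_box z0 rho0.
(* The gain is counted on [N] only, the loss on all of [K]; both boxes are chosen before [lam]. *)
set N : set mtx := tx_box z0 nr in muN0 muNoo.
set K : set mtx := tx_box z0 rho in muK0 muKoo.
have mN : measurable N by exact: measurable_tx_box.
have mK : measurable K by exact: measurable_tx_box.
pose nN := fine (mu N); pose nK := fine (mu K).
have nN0 : 0 < nN by apply: fine_gt0; rewrite muN0 muNoo.
have nK0 : 0 < nK by apply: fine_gt0; rewrite muK0 muKoo.
have cpos : 0 < c0 * nN by rewrite mulr_gt0.
have Cpos : 0 <= G * (b - a) * M * nK.
  by rewrite !mulr_ge0// ?(ltW G0) ?(ltW nK0)// subr_ge0 ltW.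
have ba0 : 0 < b - a by rewrite subr_gt0.
have [lam lam0] := exp_dominates short ba0 cpos Cpos.
apply/negP; rewrite -leNgt.
pose b0 := Num.min a 0 - 1.
have b0a : b0 < a.
  by apply: (@lt_le_trans _ _ (Num.min a 0)); rewrite ?ge_min ?lexx// /b0; lra.
have b00 : b0 < 0.
  by apply: (@lt_le_trans _ _ (Num.min a 0)); rewrite ?ge_min ?lexx ?orbT// /b0; lra.
pose m := lam * G; have m0 : 0 < m by rewrite mulr_gt0.
pose E := expR (lam * (b - a)) - 1 - lam * (b - a).
have E0 : 0 <= E.
  by rewrite /E; have := expR_ge1Dx (lam * (b - a)); move: (expR _) => y; lra.
(* Where the gain is positive [tau] exceeds [- r], and on the support of the test function it is
   below [s + r]; these give the two exponential factors. *)
pose c1 := E * (expR (- (m * r)) * c0).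
pose C1 := G * (lam ^+ 2 * (b - a)) * (expR (m * (s + r)) * M).
pose rh := trunc_rho a b v lam.
pose Theta z := entropy_production f u b0 rh (test m) z + entropy_source g' u rh (test m) z.
have low z : c1 * \1_N z - C1 * \1_K z <= sg * Theta z.
  apply: le_trans (pointwise_lower_bound z lam0 b00 b0a).
  have gz : 0 <= gain z by exact: gain_ge0.
  have eta0 : 0 <= prim b0 rh (u z) by exact: eta_ge0.
  apply: lerB.
    rewrite indicE; have [zN|zN] := boolP (z \in N); last first.
      by rewrite mulr0 mulr_ge0// mulr_ge0// expR_ge0.
    have [hg hu] : c0 <= gain z /\ b <= u z.
      by apply: hN; apply/(tx_boxP _ _ nr0); rewrite inE in zN.
    rewrite mulr1 /c1; apply: ler_pM => //.
    - by rewrite mulr_ge0 ?expR_ge0// ltW.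
    - exact: eta_ge.
    - apply: ler_pM; rewrite ?expR_ge0 ?(ltW c00)// ler_expR.
      have /andP[h1 _] : - r < tau z < r.
        apply: (gain_neq0 r0 (z := z)).
        by apply: lt0r_neq0; exact: lt_le_trans hg.
      by rewrite -mulrN ler_pM2l// ltW.
  rewrite indicE; have [t0z|t0z] := eqVneq (test m z) 0.
    rewrite t0z mulr0 mulr_ge0// /C1.
    by rewrite !mulr_ge0 ?expR_ge0 ?sqr_ge0// ?subr_ge0 ltW.
  have zK : z \in K by rewrite inE; exact: srho t0z.
  rewrite zK mulr1 /C1 ler_wpM2l//.
    by rewrite !mulr_ge0 ?sqr_ge0// ?subr_ge0 ltW.
  have [/andP[_ h2] _] := cone_test_neq0 r0 t0z.
  have -> : test m z = expR (m * tau z) * test 0 z.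
    set T := rise t0 sg r z * fall t0 sg s r z.
    change (expf t0 sg m z * T * cone z = expR (m * tau z) * (expf t0 sg 0 z * T * cone z)).
    by rewrite !expfE mul0r expR0 mul1r mulrA.
  apply: ler_pM; rewrite ?expR_ge0 ?cone_test_ge0//.
    by rewrite ler_expR ler_pM2l// ltW.
  exact: le_trans (ler_norm _) (HM z).
have ctest : elementary (test m) by exact: elementary_cone_test.
have iT : mu.-integrable setT (EFin \o Theta).
  have cr : continuous rh by exact: trunc_rho_continuous.
  have iP := entropy_production_integrable fC2 u_cont u_01 b00 ctest rho0 (srho m) cr.
  have iS := entropy_source_integrable mg' g'G u_cont ctest rho0 (srho m) cr.
  exact: (integrableD measurableT iP iS).
have IT : \int[mu]_z Theta z = 0.
  apply: (entropy_balance fC2 mg mg' g'G gg' u_cont u_01 u_isentropic b00 ctest rho0 (srho m)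
    (rho1 := rise_rho a b lam) (rho2 := fall_rho a b v lam)).
  - exact: rise_rho_continuous.
  - exact: rise_rho_homo.
  - exact: fall_rho_continuous.
  - exact: fall_rho_homo.
have iI (A : set mtx) (q : R) z1 e : 0 < e -> measurable A -> A = tx_box z1 e ->
    mu.-integrable setT (EFin \o (fun z => q * \1_A z)).
  move=> e0 mA ->; apply: (@supported_integrable R d z1 e _ `|q|) => //.
  - move=> z; rewrite indicE mulf_eq0 negb_or => /andP[_].
    by case: (boolP (z \in _)); rewrite ?inE// eqxx.
  - by move=> z; rewrite normrM indicE; case: (z \in _); rewrite /= ?normr1 ?normr0 ?mulr1 ?mulr0.
  - by apply: measurable_funM => //; apply: measurable_indic; exact: measurable_tx_box.
have II (A : set mtx) (q : R) : measurable A ->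
    \int[mu]_z (q * \1_A z) = q * fine (mu A).
  move=> mA; rewrite -(Rintegral_cst _ mA) [in RHS]Rintegral_mkcond.
  by apply: eq_Rintegral => z _; rewrite patchE indicE; case: ifP; rewrite ?mulr1 ?mulr0.
have fin : c1 * nN - C1 * nK <= 0.
  have iN := iI N c1 z0 nr nr0 mN erefl.
  have iK := iI K C1 z0 rho rho0 mK erefl.
  rewrite -(II N c1 mN) -(II K C1 mK) -RintegralB//.
  rewrite -(mulr0 sg) -IT -RintegralZl//.
  apply: le_Rintegral => //.
    exact: (integrableB measurableT iN iK).
  exact: (integrableZl measurableT sg iT).
have e1 : expR (m * r) * expR (- (m * r)) = 1 by rewrite expRN divff// gt_eqF ?expR_gt0.
(* Clearing [expR (- (m * r))] turns the exponent of the loss into [lam * G * (s + 2 * r)], the one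
   that [lam] was chosen to beat. *)
have := ler_wpM2l (expR_ge0 (m * r)) fin.
have -> : expR (m * r) * (c1 * nN - C1 * nK) =
    (expR (m * r) * expR (- (m * r))) * (c0 * nN * E)
    - G * (b - a) * M * nK * lam ^+ 2 * (expR (m * (s + r)) * expR (m * r)).
  by rewrite /c1 /C1; ring.
rewrite e1 mul1r mulr0 subr_le0 -expRD /m.
by rewrite (_ : lam * G * (s + r) + lam * G * r = lam * (G * (s + 2 * r)))//; ring.
Qed.

End core.
(** If no such [y] existed, [u] would be below [v - 2 * G * s] on a compact box at time
    [t0 + sg * s], hence also at nearby times. The test function could then be switched off there
    for free, against [no_fall]. *)
Lemma propagate (t0 : R) (x0 : 'rV[R]_d) (v sg s : R) :
  sg * sg = 1 -> 0 < s -> v <= u (t0, x0) ->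
  exists2 y : 'rV[R]_d,
    forall i, `|y ord0 i - x0 ord0 i - sg * s * speed f v ord0 i| <= 3 * L * G * s ^+ 2
    & v - 2 * G * s <= u (t0 + sg * s, y).
Proof.
move=> sg2 s0 start; apply: contrapT => noy.
pose c := speed f v; pose e := G * s; have e0 : 0 < e by rewrite mulr_gt0.
(* [b < v] makes the start strict, and [b - a = 3 * e / 2] exceeds [G * s = e] with room for [r].
   The resulting rate [k = 2 * L * e] gives the width [2 * L * e * s] at time [s], below the allowed
   [3 * L * e * s]. *)
pose a := v - 2 * e; pose b := v - e / 2; pose k := L * (v - a).
have kE : k = 2 * (L * e) by rewrite /k /a; ring.
have Le0 : 0 < L * e by rewrite mulr_gt0.
pose B := [set y : 'rV[R]_d | forall i,
  `[x0 ord0 i + sg * s * c ord0 i - 3 * (L * e * s),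
    x0 ord0 i + sg * s * c ord0 i + 3 * (L * e * s)]%classic (y ord0 i)].
have uB y : B y -> u (t0 + sg * s, y) < a.
  move=> By; rewrite ltNge; apply/negP => au; apply: noy; exists y.
    move=> i; have := By i; rewrite /= in_itv/= -/c => /andP[h1 h2].
    have -> : 3 * L * G * s ^+ 2 = 3 * (L * e * s) by rewrite /e; ring.
    by rewrite ler_norml; apply/andP; split; lra.
  by apply: le_trans au; rewrite /a /e mulrA.
have cB : compact B.
  apply: (rV_compact (A := fun i => `[x0 ord0 i + sg * s * c ord0 i - 3 * (L * e * s),
    x0 ord0 i + sg * s * c ord0 i + 3 * (L * e * s)]%classic)) => i.
  exact: segment_compact.
(* Tube lemma: compactness of [B] makes the time neighborhood uniform in [y]. *)
have [r1 /= r10 hr1] : exists2 r1, 0 < r1 &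
    ball (t0 + sg * s) r1 `<=` [set t | forall y, B y -> u (t, y) < a].
  apply/nbhs_ballP.
  apply: (compact_near_coveringP _).1 cB R (nbhs (t0 + sg * s)) (fun t y => u (t, y) < a) _ _.
  move=> y By.
  have : \forall z \near ((t0 + sg * s, y) : tx), u z < a.
    by have /cvgr_lt := (u_cont : continuous u) (t0 + sg * s, y); apply; exact: uB.
  case=> -[P Q] /= [hP hQ] PQ; exists (Q, P) => //= -[y' t'] /= [Qy Pt].
  exact: (PQ (t', y')).
pose S := \sum_(j < d) `|c ord0 j|.
have S0 : 0 <= S by apply: sumr_ge0.
have cS i : `|c ord0 i| <= S by rewrite /S (bigD1 i)//= lerDl sumr_ge0.
have k0 : 0 < k by rewrite kE mulr_gt0.
pose R0 := L * e * s / 2; have R00 : 0 < R0 by rewrite divr_gt0// mulr_gt0.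
have kS0 : 0 < k + S + 1 by lra.
(* The three bounds keep [G * (s + 2 * r)] below [b - a], the switching times in the tube, and the
   extra widening and drift during time [r] within [R0]. *)
pose r := Num.min (s / 8) (Num.min (r1 / 2) (R0 / (k + S + 1))).
have r0 : 0 < r by rewrite /r !lt_min; apply/and3P; split; rewrite divr_gt0.
have rs : r <= s / 8 by rewrite ge_min lexx.
have rr1 : r <= r1 / 2 by rewrite !ge_min lexx ?orbT.
have rR0 : r * (k + S + 1) <= R0.
  by rewrite -ler_pdivlMr// /r !ge_min lexx ?orbT.
have ab : a < b by rewrite /a /b; lra.
have bv : b < v by rewrite /b; lra.
apply: (@no_fall t0 x0 sg s R0 r a b v) => //.
- move=> z /andP[h1 h2] hc.
  have hz : z.1 - t0 = sg * tau t0 sg z by rewrite /tau mulrA sg2 mul1r.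
  have sgn x : `|sg * x| = `|x|.
    by case: (sgP sg2) => ->; rewrite ?mulN1r ?normrN ?mul1r.
  have hd : `|z.1 - t0 - sg * s| < r.
    by rewrite hz -mulrBr sgn ltr_norml; apply/andP; split; lra.
  rewrite [z]surjective_pairing; apply/ltW/hr1.
    rewrite -ball_normE/= distrC opprD addrA; apply: lt_le_trans hd _; lra.
  move=> i; have := cone_neq0 hc i; rewrite -/c -/k => h3.
  have h4 : k * tau t0 sg z <= k * (s + r) by rewrite ler_wpM2l// ltW.
  have h5 : `|(z.1 - t0 - sg * s) * c ord0 i| <= r * S.
    by rewrite normrM ler_pM// ltW.
  rewrite /= in_itv/=; move: h3 h5; rewrite ltr_norml ler_norml => /andP[h3 h3'] /andP[h5 h5'].
  have h6 : R0 + k * (s + r) + r * S <= 3 * (L * e * s).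
    have -> : 3 * (L * e * s) = k * s + 2 * R0 by rewrite kE /R0; field.
    by lra.
  by apply/andP; split; lra.
- by apply: lt_le_trans start.
- rewrite /a /b mulrDr -/e.
  have : G * (2 * r) <= e / 4 by rewrite /e -mulrA ler_pM2l//; lra.
  by lra.
Qed.

End propagation.

(** * Transversal velocities *)

Section determinant_bounds.
Context {R : realType}.

Lemma normr_det_le n (A : 'M[R]_n) (B : R) : 0 <= B -> (forall i j, `|A i j| <= B) ->
  `|\det A| <= n`!%:R * B ^+ n.
Proof.
move=> B0 AB; rewrite /determinant; apply: le_trans (ler_norm_sum _ _ _) _.
apply: le_trans (_ : \sum_(s : 'S_n) B ^+ n <= _).
  apply: ler_sum => s _; rewrite normrM normrX normrN normr1 expr1n mul1r normr_prod.
  apply: le_trans (_ : \prod_(i < n) B <= _); last by rewrite prodr_const card_ord.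
  by apply: ler_prod => i _; rewrite normr_ge0 AB.
by rewrite sumr_const card_Sn mulr_natl.
Qed.

Lemma normr_adj_le n (A : 'M[R]_n) (B : R) : 0 <= B -> (forall i j, `|A i j| <= B) ->
  forall i j, `|\adj A i j| <= n.-1`!%:R * B ^+ n.-1.
Proof.
move=> B0 AB i j; rewrite mxE /cofactor normrM normrX normrN normr1 expr1n mul1r.
by apply: normr_det_le => // k l; rewrite !mxE.
Qed.

(** Cramer's rule through the adjugate, with cofactors bounded by the Leibniz expansion. *)
Lemma solve_row n (A : 'M[R]_n) (y : 'rV[R]_n) (B D Y : R) :
  0 <= B -> (forall i j, `|A i j| <= B) -> 0 < D -> D <= `|\det A| ->
  (forall i, `|y ord0 i| <= Y) ->
  exists2 s : 'rV[R]_n, s *m A = y &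
    forall j, `|s ord0 j| <= n%:R * (n.-1`!%:R * B ^+ n.-1) * Y / D.
Proof.
move=> B0 AB D0 DA yY.
have dA : \det A != 0 by rewrite -normr_gt0 (lt_le_trans D0).
exists ((\det A)^-1 *: (y *m \adj A)).
  by rewrite -scalemxAl -mulmxA mul_adj_mx mul_mx_scalar scalerA mulVf// scale1r.
move=> j; rewrite mxE normrM normfV mulrC.
have Y0 : 0 <= Y by exact: le_trans (yY j).
have K0 : 0 <= n.-1`!%:R * B ^+ n.-1 :> R by rewrite mulr_ge0 ?exprn_ge0.
have h1 : `|(y *m \adj A) ord0 j| <= n%:R * (n.-1`!%:R * B ^+ n.-1) * Y.
  rewrite mxE; apply: le_trans (ler_norm_sum _ _ _) _.
  apply: le_trans (_ : \sum_(i < n) Y * (n.-1`!%:R * B ^+ n.-1) <= _).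
    by apply: ler_sum => i _; rewrite normrM ler_pM// normr_adj_le.
  by rewrite sumr_const card_ord -mulr_natl; lra.
apply: ler_pM; rewrite ?invr_ge0//.
by rewrite lef_pV2// posrE (lt_le_trans D0).
Qed.

Lemma exists_unit_orthogonal n d (e : 'I_n -> 'rV[R]_d) : (n < d)%N ->
  exists2 xi : 'rV[R]_d, dotr xi xi = 1 & forall j, dotr (e j) xi = 0.
Proof.
move=> nd; pose A : 'M[R]_(n, d) := \matrix_j e j.
have : kermx A^T != 0.
  rewrite -mxrank_eq0 mxrank_ker mxrank_tr subn_eq0 -ltnNge.
  exact: leq_ltn_trans (rank_leq_row _) nd.
case/rowV0Pn => x /sub_kermxP xA x0.
have dx0 : 0 < dotr x x.
  rewrite lt_def; apply/andP; split; last first.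
    by apply: sumr_ge0 => i _; rewrite -expr2 sqr_ge0.
  apply: contra_neq x0 => /eqP; rewrite psumr_eq0; last first.
    by move=> i _; rewrite -expr2 sqr_ge0.
  move=> /allP h; apply/rowP => i; rewrite mxE.
  by have := h i (mem_index_enum _); rewrite /= mulf_eq0 orbb => /eqP.
have sx0 : 0 < enorm x by rewrite sqrtr_gt0.
exists ((enorm x)^-1 *: x).
  rewrite /dotr (eq_bigr (fun i => (enorm x) ^- 2 * (x ord0 i * x ord0 i))); last first.
    by move=> i _; rewrite !mxE -exprVn; ring.
  rewrite -mulr_sumr -/(dotr x x) /enorm sqr_sqrtr ?(ltW dx0)// mulVf//.
  by rewrite gt_eqF.
move=> j; rewrite /dotr (eq_bigr (fun i => (enorm x)^-1 * (x ord0 i * A j i))); last first.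
  by move=> i _; rewrite !mxE; ring.
have /rowP/(_ j) := xA; rewrite !mxE => h.
rewrite -mulr_sumr; rewrite (eq_bigr (fun i => x ord0 i * A^T i j)) ?h ?mulr0//.
by move=> i _; rewrite !mxE.
Qed.

Lemma dotr_unit_le1 d (xi : 'rV[R]_d) i : dotr xi xi = 1 -> `|xi ord0 i| <= 1.
Proof.
move=> h; rewrite -(@ler_sqr _ _ 1) ?nnegrE// expr1n real_normK ?num_real//.
rewrite -h /dotr (bigD1 i)//= -expr2 lerDl.
by apply: sumr_ge0 => j _; rewrite -expr2 sqr_ge0.
Qed.

(* The Gram matrix of the chosen vectors against the unit vectors is
   triangular, which bounds its determinant from below. *)
Lemma transversal_det d (e xi : 'I_d -> 'rV[R]_d) (delta : R) : 0 <= delta ->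
  (forall k, dotr (xi k) (xi k) = 1) ->
  (forall j k : 'I_d, (j < k)%N -> dotr (e j) (xi k) = 0) ->
  (forall k, delta <= `|dotr (e k) (xi k)|) ->
  delta ^+ d / d`!%:R <= `|\det (\matrix_j e j)|.
Proof.
move=> d0 xi1 exi edelta.
pose M : 'M[R]_d := \matrix_j e j; pose X : 'M[R]_d := \matrix_j xi j.
have MX j k : (M *m X^T) j k = dotr (e j) (xi k).
  by rewrite mxE; apply: eq_bigr => i _; rewrite !mxE.
have trig : is_trig_mx (M *m X^T) by apply/is_trig_mxP => i j ij; rewrite MX exi.
have dX : `|\det X| <= d`!%:R.
  have X1 i j : `|X i j| <= 1 by rewrite mxE dotr_unit_le1.
  by have := normr_det_le ler01 X1; rewrite expr1n mulr1.
have f0 : (0 : R) < d`!%:R by rewrite ltr0n fact_gt0.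
have h : delta ^+ d <= `|\det M| * `|\det X|.
  rewrite -normrM -(det_tr X) -det_mulmx det_trig// normr_prod.
  apply: le_trans (_ : \prod_(i < d) delta <= _); first by rewrite prodr_const card_ord.
  by apply: ler_prod => i _; rewrite d0 MX edelta.
rewrite ler_pdivrMr//; apply: le_trans h _.
by rewrite ler_wpM2l.
Qed.

End determinant_bounds.

Lemma normr_scale_lt (R : realType) (N A delta : R) : 1 <= N -> `|A| < delta ->
  `|N^-1 * A| < delta.
Proof.
move=> N1; apply: le_lt_trans; have N0 : 0 < N by exact: lt_le_trans N1.
by rewrite normrM gtr0_norm ?invr_gt0// ler_piMl// invf_le1.
Qed.

Section transversal_speeds.
Context {R : realType} {d : nat}.
Local Notation I01 := (`[0, 1]%classic : set R).
Local Notation leb := (@lebesgue_measure R).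
Variables (f : R -> 'rV[R]_d) (alpha C L : R).
Hypotheses (fC2 : C2_in I01 f) (L0 : 0 < L)
  (speedL : forall w w' i, `|speed f w ord0 i - speed f w' ord0 i| <= L * `|w - w'|)
  (Hnl : forall (tau : R) (xi : 'rV[R]_d) (delta : R),
    Num.sqrt (tau ^+ 2 + dotr xi xi) = 1 -> 0 < delta ->
    let E := [set v : R | v \in `[0, 1] /\
               `|tau + dotr (derive_in I01 f v) xi| < delta] in
    (leb E <= (C * delta `^ alpha)%:E)%E).

Lemma dotrZr (a : R) (x y : 'rV[R]_d) : dotr x (a *: y) = a * dotr x y.
Proof. by rewrite /dotr mulr_sumr; apply: eq_bigr => i _; rewrite mxE; ring. Qed.

Lemma dotrZl (a : R) (x y : 'rV[R]_d) : dotr (a *: x) y = a * dotr x y.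
Proof. by rewrite /dotr mulr_sumr; apply: eq_bigr => i _; rewrite mxE; ring. Qed.

Lemma dotrBl (x x' y : 'rV[R]_d) : dotr (x - x') y = dotr x y - dotr x' y.
Proof. by rewrite /dotr -sumrB; apply: eq_bigr => i _; rewrite !mxE; ring. Qed.

(** Otherwise [f' v] stays within [delta] of [f' p] in direction [xi] on an interval of length [l],
    and nonlinearity with [tau = - f' p . xi] forces [l <= C * delta^alpha]. *)
Lemma speed_oscillation (xi : 'rV[R]_d) (p l delta : R) : dotr xi xi = 1 ->
  0 <= p -> p + l <= 1 -> 0 < delta -> 0 < l -> C * delta `^ alpha < l ->
  exists v w, [/\ p <= w, w <= v, v <= p + l &
    delta <= `|dotr (speed f v - speed f w) xi|].
Proof.
move=> xi1 p0 pl delta0 l0 Cl; apply: contrapT => no.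
have osc v : p <= v <= p + l -> `|dotr (speed f v - speed f p) xi| < delta.
  move=> /andP[pv vl]; rewrite ltNge; apply/negP => h.
  by apply: no; exists v, p; split.
have [t0 t0E] : exists t0, t0 = - dotr (speed f p) xi by eexists.
have t01 : 0 < t0 ^+ 2 + 1 by rewrite ltr_wpDl// sqr_ge0.
(* [N] normalizes the vector [(t0, xi)]. It is at least 1 because [xi] is a unit vector, so dividing
   by it preserves the bound [delta]. *)
have [N NE] : exists N, N = Num.sqrt (t0 ^+ 2 + 1) by eexists.
have N1 : 1 <= N by rewrite NE -[leLHS]sqrtr1 ler_wsqrtr// lerDr sqr_ge0.
have N0 : 0 < N by exact: lt_le_trans N1.
have unit1 : Num.sqrt ((t0 / N) ^+ 2 + dotr (N^-1 *: xi) (N^-1 *: xi)) = 1.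
  rewrite dotrZl dotrZr xi1 mulr1 (_ : _ + _ = (t0 ^+ 2 + 1) / N ^+ 2).
    by rewrite NE sqr_sqrtr ?(ltW t01)// divff ?sqrtr1// gt_eqF.
  by rewrite -exprVn; ring.
have := Hnl unit1 delta0.
move=> /=; set E := [set v | _]; move=> hE.
pose h v := `|t0 / N + dotr (speed f v) (N^-1 *: xi)|.
have ch : continuous h.
  move=> v; apply: cvg_norm; apply: cvgD; first exact: cvg_cst.
  apply: (@continuous_sumr R R _ _ (fun i v => speed f v ord0 i * (N^-1 *: xi) ord0 i)).
  by move=> i {}v; apply: cvgMl; exact: speed_continuous.
have speed_in v : v \in `[0, 1] -> derive_in I01 f v = speed f v.
  by move=> vI; rewrite /speed clamp01_id.
have EE : E = `[0, 1]%classic `&` h @^-1` `]-oo, delta[%classic.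
  apply/seteqP; split=> v /= [vI vd]; split; try exact: vI.
    by rewrite in_itv/= /h -speed_in.
  by move: vd; rewrite in_itv/= /h -speed_in.
have mE : measurable E.
  have mh := continuous_measurable_fun ch measurableT (measurable_itv `]-oo, delta[).
  by rewrite setTI in mh; rewrite EE; exact: measurableI (measurable_itv _) mh.
have sub : `[p, p + l]%classic `<=` E.
  move=> v /=; rewrite in_itv/= => vI; have /andP[pv vl] := vI.
  have v01 : v \in `[0, 1] by rewrite in_itv/=; apply/andP; split; lra.
  split; first exact: v01.
  have := osc v vI; rewrite dotrBl (speed_in _ v01).
  move: (speed f v) => y hD.
  have -> : t0 / N + dotr y (N^-1 *: xi) = N^-1 * (dotr y xi - dotr (speed f p) xi).
    by rewrite dotrZr t0E; move: (dotr y xi) (dotr _ xi) => A B; ring.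
  move: hD; move: (dotr y xi - _) => A hD.
  exact: normr_scale_lt.
have hpl : lebesgue_measure (`[p, p + l]%classic : set R) = l%:E.
  by rewrite lebesgue_measure_itv/= lte_fin ltrDl l0 -EFinB addrAC subrr add0r.
have : (l%:E <= (C * delta `^ alpha)%:E)%E.
  rewrite -hpl; apply: le_trans hE.
  by apply: le_measure; [exact: mem_set (measurable_itv _)|exact: mem_set mE|exact: sub].
by rewrite lee_fin leNgt Cl.
Qed.

(** A Gram-Schmidt type choice: fewer than [d] differences leave a unit vector orthogonal to all of
    them, and the next interval contains a pair oscillating along it. *)
Lemma transversal_selection (p : nat -> R) (l delta : R) n : (n <= d)%N ->
  (forall k, (k < d)%N -> 0 <= p k /\ p k + l <= 1) ->
  0 < delta -> 0 < l -> C * delta `^ alpha < l ->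
  exists v w : nat -> R, exists xi : nat -> 'rV[R]_d, forall k, (k < n)%N ->
    [/\ p k <= w k, w k <= v k, v k <= p k + l, dotr (xi k) (xi k) = 1 &
      delta <= `|dotr (speed f (v k) - speed f (w k)) (xi k)| /\
      forall j, (j < k)%N -> dotr (speed f (v j) - speed f (w j)) (xi k) = 0].
Proof.
move=> nd hp d0 l0 Cl; elim: n nd => [|n IH] nd; first by exists (cst 0), (cst 0), (cst 0).
have [v [w [xi H]]] := IH (ltnW nd).
have [x x1 xo] := exists_unit_orthogonal
  (fun j : 'I_n => speed f (v j) - speed f (w j)) nd.
have [p0 p1] := hp n nd.
have [vn [wn [h1 h2 h3 h4]]] := speed_oscillation x1 p0 p1 d0 l0 Cl.
exists (fun k => if k == n then vn else v k), (fun k => if k == n then wn else w k),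
  (fun k => if k == n then x else xi k) => k.
have lt_neq j : (j < n)%N -> (j == n) = false by move=> jn; rewrite ltn_eqF.
rewrite ltnS leq_eqVlt => /predU1P[->|kn].
  rewrite eqxx; split => //; split => // j jn; rewrite lt_neq//.
  exact: (xo (Ordinal jn)).
rewrite (lt_neq _ kn); have [a1 a2 a3 a4 [a5 a6]] := H k kn.
split; [exact: a1|exact: a2|exact: a3|exact: a4|split; first exact: a5].
by move=> j jk; rewrite (lt_neq _ (ltn_trans jk kn)); exact: a6.
Qed.

(** The Cramer bound with entries at most [L], times the [d!] from the lower bound on the
    determinant. *)
Definition solve_const : R := d%:R * (d.-1`!%:R * L ^+ d.-1) * d`!%:R.

Lemma solve_speeds (p : nat -> R) (l delta Y : R) (y : 'rV[R]_d) :
  (forall k, (k < d)%N -> 0 <= p k /\ p k + l <= 1) ->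
  0 < delta -> 0 < l -> C * delta `^ alpha < l -> (forall i, `|y ord0 i| <= Y) ->
  exists v w : nat -> R, exists s : nat -> R,
  [/\ forall k, (k < d)%N -> [/\ p k <= w k, w k <= v k & v k <= p k + l],
    forall i, \sum_(k < d) s k * (speed f (v k) ord0 i - speed f (w k) ord0 i) = y ord0 i
    & forall k, (k < d)%N -> `|s k| <= solve_const * Y / delta ^+ d].
Proof.
move=> hp d0 l0 Cl yY.
have [v [w [xi H]]] := transversal_selection (leqnn d) hp d0 l0 Cl.
pose e (j : 'I_d) := speed f (v j) - speed f (w j).
have Hdet : delta ^+ d / d`!%:R <= `|\det (\matrix_j e j)|.
  apply: (@transversal_det R d e (fun k => xi k)) => [|k|j k jk|k]; first exact: ltW.
  - by have [] := H k (ltn_ord k).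
  - by have [_ _ _ _ [_ ]] := H k (ltn_ord k); apply.
  - by have [_ _ _ _ []] := H k (ltn_ord k).
have f0 : (0 : R) < d`!%:R by rewrite ltr0n fact_gt0.
have D0 : 0 < delta ^+ d / d`!%:R by rewrite divr_gt0// exprn_gt0.
have ML i j : `|(\matrix_j e j : 'M[R]_d) i j| <= L.
  rewrite mxE /e !mxE; apply: le_trans (speedL _ _ _) _.
  have [p0 p1] := hp i (ltn_ord i); have [h1 h2 h3 _ _] := H i (ltn_ord i).
  rewrite -[leRHS]mulr1 ler_wpM2l ?(ltW L0)// ler_norml; apply/andP; split; lra.
have [s sM sb] := solve_row (ltW L0) ML D0 Hdet yY.
exists v, w, (fun k => if insub k is Some i then s ord0 i else 0); split.
- by move=> k kd; have [] := H k kd.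
- move=> i; rewrite -sM mxE; apply: eq_bigr => k _.
  by rewrite valK !mxE.
- move=> k kd; rewrite insubT; apply: le_trans (sb _) _.
  by rewrite invf_div /solve_const le_eqVlt; apply/orP; left; apply/eqP; ring.
Qed.

End transversal_speeds.

(** * From propagation to the modulus of continuity *)

Section chain.
Context {R : realType} {d : nat}.
Local Notation tx := (R * 'rV[R]_d)%type.
Local Notation I01 := (`[0, 1]%classic : set R).
Variables (f : R -> 'rV[R]_d) (u : tx -> R) (G L alpha C K : R).
Hypotheses (d0 : (0 < d)%N) (G0 : 0 < G) (L0 : 0 < L) (C0 : 0 < C) (K0 : 0 <= K)
  (alpha0 : 0 < alpha) (alpha1 : alpha <= 1)
  (u_cont : continuous u) (u_01 : forall z, u z \in `[0, 1])
  (speedL : forall w w' i, `|speed f w ord0 i - speed f w' ord0 i| <= L * `|w - w'|)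
  (solve : forall (p : nat -> R) (l delta Y : R) (y : 'rV[R]_d),
    (forall k, (k < d)%N -> 0 <= p k /\ p k + l <= 1) ->
    0 < delta -> 0 < l -> C * delta `^ alpha < l -> (forall i, `|y ord0 i| <= Y) ->
    exists v w : nat -> R, exists s : nat -> R,
    [/\ forall k, (k < d)%N -> [/\ p k <= w k, w k <= v k & v k <= p k + l],
      forall i, \sum_(k < d) s k * (speed f (v k) ord0 i - speed f (w k) ord0 i) = y ord0 i
      & forall k, (k < d)%N -> `|s k| <= K * Y / delta ^+ d])
  (prop : forall (t0 : R) (x0 : 'rV[R]_d) (v sg s : R),
    sg * sg = 1 -> 0 < s -> v <= u (t0, x0) ->
    exists2 y : 'rV[R]_d,
      forall i, `|y ord0 i - x0 ord0 i - sg * s * speed f v ord0 i| <= 3 * L * G * s ^+ 2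
      & v - 2 * G * s <= u (t0 + sg * s, y)).

Lemma move_along (t : R) (x : 'rV[R]_d) (v s : R) : v <= u (t, x) ->
  exists2 y : 'rV[R]_d,
    forall i, `|y ord0 i - x ord0 i - s * speed f v ord0 i| <= 3 * L * G * `|s| ^+ 2
    & v - 2 * G * `|s| <= u (t + s, y).
Proof.
move=> vu; have [s0|s0|->] := ltgtP s 0; last first.
- exists x; last by rewrite normr0 mulr0 subr0 addr0.
  by move=> i; rewrite subrr mul0r subrr !normr0 expr0n mulr0.
- have [|y h1 h2] := @prop t x v 1 s _ s0 vu; first by rewrite mulr1.
  by rewrite mul1r in h1 h2; exists y; rewrite gtr0_norm.
- have ns0 : 0 < - s by rewrite oppr_gt0.
  have [|y h1 h2] := @prop t x v (-1) (- s) _ ns0 vu; first by rewrite mulrNN mulr1.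
  by rewrite mulrNN mul1r in h1 h2; exists y; rewrite ltr0_norm.
Qed.

(** Here [th] is the loss accumulated so far: speeds are wanted at [v] and [w] but used at values
    lowered by [th] and by [th + 2 * G * |s|]. The coefficient 8 is 3 from each leg plus 2 from the
    loss of the first leg. *)
Lemma move_pair (t : R) (x : 'rV[R]_d) (v w s th : R) : w <= v -> 0 <= th ->
  v - th <= u (t, x) ->
  exists2 y : 'rV[R]_d,
    forall i, `|y ord0 i - x ord0 i - s * (speed f v ord0 i - speed f w ord0 i)|
      <= 8 * L * G * `|s| ^+ 2 + 2 * L * `|s| * th
    & w - th - 4 * G * `|s| <= u (t, y).
Proof.
move=> wv th0 /(move_along s)[y1 hy1 uy1].
have [|y hy uy] := @move_along (t + s) y1 (w - th - 2 * G * `|s|) (- s).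
  by apply: le_trans uy1; lra.
rewrite normrN addrK in uy hy; exists y; last by apply: le_trans uy; lra.
move=> i.
have Gs : 0 <= 2 * G * `|s| by rewrite !mulr_ge0// ltW.
have e1 := hy1 i; have e2 := hy i.
have l1 := speedL (v - th) v i; have l2 := speedL (w - th - 2 * G * `|s|) w i.
rewrite (_ : v - th - v = - th) in l1; last by ring.
rewrite (_ : w - th - 2 * G * `|s| - w = - (th + 2 * G * `|s|)) in l2; last by ring.
rewrite normrN (ger0_norm th0) in l1; rewrite normrN (ger0_norm (addr_ge0 th0 Gs)) in l2.
move: e1 e2 l1 l2; set A := speed f (v - th) ord0 i.
set B := speed f (w - th - 2 * G * `|s|) ord0 i.
move=> e1 e2 l1 l2.
have m1 : `|s * (A - speed f v ord0 i)| <= `|s| * (L * th) by rewrite normrM ler_wpM2l.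
have m2 : `|s * (B - speed f w ord0 i)| <= `|s| * (L * (th + 2 * G * `|s|)).
  by rewrite normrM ler_wpM2l//.
have -> : y ord0 i - x ord0 i - s * (speed f v ord0 i - speed f w ord0 i) =
  (y1 ord0 i - x ord0 i - s * A) + (y ord0 i - y1 ord0 i - - s * B)
  + (s * (A - speed f v ord0 i) - s * (B - speed f w ord0 i)) by ring.
apply: le_trans (ler_normD _ _) _.
apply: le_trans (lerD (ler_normD _ _) (ler_normB _ _)) _.
apply: le_trans (lerD (lerD e1 e2) (lerD m1 m2)) _.
by rewrite le_eqVlt; apply/orP; left; apply/eqP; ring.
Qed.

(** The value intervals descend from [b], so after [n] pairs the guaranteed value is still [v n] up
    to the loss [4 * G * S * n] due to time. Bounding this loss by its value at [d] produces the
    factor [1 + d]. *)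
Lemma move_chain (t b l S : R) (x : 'rV[R]_d) (v w s : nat -> R) n : (n <= d)%N ->
  b <= u (t, x) -> 0 <= S ->
  (forall k, (k < d)%N -> [/\ b - k.+1%:R * l <= w k, w k <= v k,
     v k <= b - k%:R * l & `|s k| <= S]) ->
  exists2 y : 'rV[R]_d,
    forall i, `|y ord0 i - x ord0 i
      - \sum_(k < n) s k * (speed f (v k) ord0 i - speed f (w k) ord0 i)|
      <= n%:R * (8 * L * G * (1 + d%:R) * S ^+ 2)
    & b - n%:R * l - 4 * G * S * n%:R <= u (t, y).
Proof.
move=> nd bu S0 H; elim: n nd => [|n IH] nd.
  exists x; last by rewrite !mul0r mulr0 !subr0.
  by move=> i; rewrite big_ord0 subrr subr0 normr0 mul0r.
have [y hy uy] := IH (ltnW nd).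
have [h1 h2 h3 h4] := H n nd.
have GS0 : 0 <= 4 * G * S by rewrite !mulr_ge0// ltW.
have th0 : 0 <= 4 * G * S * n%:R by rewrite mulr_ge0.
have [|y' hy' uy'] := @move_pair t y (v n) (w n) (s n) (4 * G * S * n%:R) h2 th0.
  by apply: le_trans uy; rewrite lerD2r.
have Gs : 4 * G * `|s n| <= 4 * G * S by rewrite ler_wpM2l// !mulr_ge0// ltW.
exists y'; last first.
  by apply: le_trans uy'; rewrite -!natr1 in h1 *; lra.
move=> i; rewrite big_ord_recr /=.
have -> : forall X Z, y' ord0 i - x ord0 i - (X + Z) =
  (y ord0 i - x ord0 i - X) + (y' ord0 i - y ord0 i - Z) by move=> X Z; ring.
apply: le_trans (ler_normD _ _) _; rewrite -natr1 mulrDl mul1r.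
apply: lerD (hy i) _; apply: le_trans (hy' i) _.
have ss : `|s n| ^+ 2 <= S ^+ 2 by rewrite lerXn2r// nnegrE.
have nd' : (n%:R : R) <= d%:R by rewrite ler_nat ltnW.
have LG0 : 0 <= 8 * L * G by rewrite !mulr_ge0// ltW.
have -> : 8 * L * G * (1 + d%:R) * S ^+ 2 = 8 * L * G * S ^+ 2 + 8 * L * G * (S * S * d%:R).
  by rewrite expr2; ring.
apply: lerD; first by rewrite ler_wpM2l.
have -> : 2 * L * `|s n| * (4 * G * S * n%:R) = 8 * L * G * (`|s n| * S * n%:R) by ring.
by rewrite ler_wpM2l// ler_pM ?mulr_ge0// ler_wpM2r.
Qed.

Let p : R := 2 * d%:R / alpha.

Let dR : (1 : R) <= d%:R. Proof. by rewrite ler1n. Qed.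

Let p1 : 1 <= p.
Proof. by rewrite /p ler_pdivlMr// mul1r; have := alpha1; have := dR; lra. Qed.

(** One round of the iteration: half of the value budget [h] is spent, and the remaining distance
    fits the remaining budget in the same relation. *)
Definition improvable (c : R) : Prop := forall (t b h : R) (x z : 'rV[R]_d),
  0 < h -> b <= 1 -> 0 <= b - h -> b <= u (t, x) ->
  (forall i, `|z ord0 i - x ord0 i| <= c * h `^ p) ->
  exists2 y : 'rV[R]_d, b - h / 2 <= u (t, y) &
    forall i, `|z ord0 i - y ord0 i| <= c * (h / 2) `^ p.

Lemma improvable_exists : exists2 c, 0 < c & improvable c.
Proof.
have dR0 : 0 < d%:R :> R by rewrite ltr0n.
pose q := d%:R / alpha.
have q1 : 1 <= q by rewrite /q ler_pdivlMr// mul1r; have := alpha1; have := dR; lra.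
(* With [delta = (h / D)^(1 / alpha)], this [D] gives [C * delta^alpha = l / 2], and [A] is the
   constant in [delta ^+ d = A * h^(d / alpha)]. *)
pose D := 8 * d%:R * C; have D0 : 0 < D by rewrite !mulr_gt0.
pose A := D^-1 `^ q; have A0 : 0 < A by rewrite powR_gt0// invr_gt0.
pose K1 := K / A.
have K10 : 0 <= K1 by rewrite divr_ge0// ltW.
pose K2 := d%:R * (8 * L * G * (1 + d%:R)).
have K20 : 0 <= K2 by rewrite !mulr_ge0 ?addr_ge0 ?(ltW L0) ?(ltW G0).
pose P2 : R := 2^-1 `^ p; have P20 : 0 < P2 by rewrite powR_gt0.
(* The times are at most [S = K1 * c * H]. The first bound on [c] keeps the loss [4 * G * S * d]
   below [h / 4]; the second keeps the position error [K2 * S ^+ 2] below [c * (h / 2)^p], since it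
   is quadratic in [c]. *)
pose c := Num.min (16 * G * d%:R * K1 + 1)^-1 (P2 / (K2 * K1 ^+ 2 + 1)).
have KG : 0 <= 16 * G * d%:R * K1.
  by rewrite mulr_ge0// mulr_ge0// mulr_ge0// ltW.
have k1 : 0 < 16 * G * d%:R * K1 + 1 by lra.
have KK : 0 <= K2 * K1 ^+ 2 by rewrite mulr_ge0// sqr_ge0.
have k2 : 0 < K2 * K1 ^+ 2 + 1 by lra.
have c0 : 0 < c by rewrite lt_min invr_gt0 k1 divr_gt0.
have c1 : c * (16 * G * d%:R * K1) <= 1.
  have : c * (16 * G * d%:R * K1 + 1) <= 1 by rewrite -ler_pdivlMr// mul1r ge_min lexx.
  by lra.
have c2 : c * (K2 * K1 ^+ 2) <= P2.
  have : c * (K2 * K1 ^+ 2 + 1) <= P2 by rewrite -ler_pdivlMr// ge_min lexx orbT.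
  by lra.
exists c => // t b h x z h0 b1 bh bu zx.
have h1 : h <= 1 by lra.
pose H := h `^ q; have H0 : 0 < H by rewrite powR_gt0.
have h01 : 0 < h <= 1 by rewrite h0.
have Hh : H <= h by have := ger_powR h01 q1; rewrite powRr1// ltW.
have hp : h `^ p = H ^+ 2.
  rewrite /H -powR_mulrn ?powR_ge0// -powRrM; congr (_ `^ _).
  by rewrite /p /q; ring.
(* The [d] intervals use up [h / 4] of value, which leaves [h / 4] for the loss due to time. *)
pose l := h / (4 * d%:R); have l0 : 0 < l by rewrite divr_gt0// mulr_gt0.
have dl : d%:R * l = h / 4 by rewrite /l; field; rewrite gt_eqF.
pose delta := (h / D) `^ alpha^-1.
have hD : 0 < h / D by rewrite divr_gt0.
have delta0 : 0 < delta by rewrite powR_gt0.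
have Cl : C * delta `^ alpha < l.
  rewrite /delta -powRrM mulVf ?gt_eqF// powRr1 ?ltW//.
  have -> : C * (h / D) = l / 2 by rewrite /D /l; field; rewrite !gt_eqF.
  by rewrite ltr_pdivrMr// ltr_pMr// ltr1n.
have dd : delta ^+ d = A * H.
  rewrite /delta -powR_mulrn ?powR_ge0// -powRrM powRM ?invr_ge0 ?ltW// mulrC.
  by rewrite /A /H /q [alpha^-1 * _]mulrC.
pose pk (k : nat) : R := b - k.+1%:R * l.
have hpk k : (k < d)%N -> 0 <= pk k /\ pk k + l <= 1.
  move=> kd; have kd' : k.+1%:R * l <= d%:R * l by rewrite ler_pM2r// ler_nat.
  have k0 : 0 <= k%:R * l by rewrite mulr_ge0// ltW.
  rewrite dl in kd'; split; first by rewrite /pk; lra.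
  by rewrite /pk -natr1 mulrDl mul1r; lra.
have zx' i : `|(z - x) ord0 i| <= c * h `^ p by rewrite !mxE; exact: zx.
have [v [w [s [hvw hs sb]]]] := solve hpk delta0 l0 Cl zx'.
pose S := K1 * c * H; have S0 : 0 <= S by rewrite /S mulr_ge0 ?(ltW H0)// mulr_ge0// ltW.
have SE : K * (c * h `^ p) / delta ^+ d = S.
  rewrite hp dd /S /K1; field; rewrite !gt_eqF//.
have chainH k : (k < d)%N -> [/\ b - k.+1%:R * l <= w k, w k <= v k,
     v k <= b - k%:R * l & `|s k| <= S].
  move=> kd; have [a1 a2 a3] := hvw k kd; split => //.
    by apply: le_trans a3 _; rewrite /pk -natr1 mulrDl mul1r; lra.
  by rewrite -SE; exact: sb.
have [y hy uy] := move_chain (leqnn d) bu S0 chainH.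
exists y.
  apply: le_trans uy; rewrite dl.
  have : 4 * G * S * d%:R <= h / 4.
    have -> : 4 * G * S * d%:R = (c * (16 * G * d%:R * K1)) * H / 4 by rewrite /S; field.
    rewrite ler_pM2r//; apply: le_trans Hh; rewrite -[leRHS]mul1r ler_pM2r//.
  by lra.
move=> i; have := hy i; rewrite hs !mxE => hyi.
have -> : z ord0 i - y ord0 i = - (y ord0 i - x ord0 i - (z ord0 i - x ord0 i)) by ring.
rewrite normrN; apply: le_trans hyi _.
rewrite powRM ?invr_ge0// ?(ltW h0)// hp -/P2.
have -> : d%:R * (8 * L * G * (1 + d%:R) * S ^+ 2) = c * H ^+ 2 * (c * (K2 * K1 ^+ 2)).
  by rewrite /K2 /S; ring.
rewrite [leRHS]mulrA; apply: ler_wpM2l c2; rewrite mulr_ge0 ?sqr_ge0// ltW//.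
Qed.

(** Halving [n] times loses [h * (1 - 2^-n)], always less than [h], while the reached points
    converge to [z]; continuity of [u] gives the bound at [z] itself. *)
Lemma improve_limit (c : R) : 0 < c -> improvable c ->
  forall (t b h : R) (x z : 'rV[R]_d), 0 < h -> b <= 1 -> 0 <= b - h -> b <= u (t, x) ->
  (forall i, `|z ord0 i - x ord0 i| <= c * h `^ p) -> b - h <= u (t, z).
Proof.
move=> c0 Hc t b h x z h0 b1 bh bu zx.
have it n : exists2 y : 'rV[R]_d, b - h * (1 - 2^-1 ^+ n) <= u (t, y) &
    forall i, `|z ord0 i - y ord0 i| <= c * (h * 2^-1 ^+ n) `^ p.
  elim: n => [|n [y uy zy]].
    by exists x; rewrite expr0 ?subrr ?mulr0 ?subr0// => i; rewrite mulr1.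
  have e0 : 0 < (2^-1 : R) ^+ n by rewrite exprn_gt0// invr_gt0.
  have e1 : (2^-1 : R) ^+ n <= 1 by rewrite exprn_ile1// invf_le1// ler1n.
  have he : h * (1 - 2^-1 ^+ n) >= 0 by rewrite mulr_ge0 ?(ltW h0)// subr_ge0.
  have bh' : 0 <= b - h * (1 - 2^-1 ^+ n) - h * 2^-1 ^+ n.
    by rewrite (_ : _ - _ = b - h)//; ring.
  have [||y' uy' zy'] := Hc t (b - h * (1 - 2^-1 ^+ n)) (h * 2^-1 ^+ n) y z _ _ bh' uy zy.
  - exact: mulr_gt0.
  - by lra.
  exists y'.
    apply: le_trans uy'; rewrite le_eqVlt; apply/orP; left; apply/eqP.
    by rewrite exprSr; field.
  by move=> i; have := zy' i; rewrite exprSr mulrA.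
rewrite leNgt; apply/negP => uz.
have [e /= e0 he] : exists2 e, 0 < e & ball ((t, z) : tx) e `<=` [set z | u z < b - h].
  apply/nbhs_ballP.
  by have /cvgr_lt := (u_cont : continuous u) (t, z); apply.
have [n hn] : exists n, c * 2^-1 ^+ n < e.
  have ec : 0 < e / c by rewrite divr_gt0.
  have : (2^-1 : R) ^+ n @[n --> \oo] --> (0 : R).
    by apply: cvg_expr; rewrite gtr0_norm ?invr_gt0// invf_lt1// ltr1n.
  move=> /cvgr_lt/(_ _ ec)[n _ hn].
  by exists n; have := hn n (leqnn n); rewrite /= ltr_pdivlMr// mulrC.
have [y uy zy] := it n.
have e0' : 0 < (2^-1 : R) ^+ n by rewrite exprn_gt0// invr_gt0.
have e1 : (2^-1 : R) ^+ n <= 1 by rewrite exprn_ile1// invf_le1// ler1n.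
have yb : ball ((t, z) : tx) e (t, y).
  apply/(tx_boxP _ _ e0); split => /=; first exact: ballxx.
  move=> i; rewrite distrC; apply: le_lt_trans (zy i) _; apply: le_lt_trans hn.
  rewrite ler_pM2l//.
  (* As [p >= 1] and the base is at most 1, the power is at most the base, hence at most [2^-n]. *)
  have hp : 0 < h * 2^-1 ^+ n by rewrite mulr_gt0.
  have h1 : h <= 1 by lra.
  have hle : h * 2^-1 ^+ n <= 2^-1 ^+ n by rewrite ler_piMl// ltW.
  have hp1 : 0 < h * 2^-1 ^+ n <= 1 by rewrite hp (le_trans hle).
  by apply: le_trans (ger_powR hp1 p1) _; rewrite powRr1// ltW.
have := he _ yb; rewrite /= ltNge => /negP; apply.
apply: le_trans uy; rewrite lerD2l lerN2 ger_pMr// gerBl ltW//.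
Qed.

End chain.

(** * From one-sided bounds to the Hölder estimate *)

Section hoelder.
Context {R : realType} {d : nat}.

Lemma enorm_ge_coord (x : 'rV[R]_d) i : `|x ord0 i| <= enorm x.
Proof.
rewrite -sqrtr_sqr; apply: ler_wsqrtr; rewrite /dotr (bigD1 i)//= -expr2 lerDl.
by apply: sumr_ge0 => j _; rewrite -expr2 sqr_ge0.
Qed.

(** The loss [h] is chosen with [c * h^(1 / gamma)] equal to the Euclidean distance, which dominates
    every coordinate difference; the one-sided bound is then applied in both directions. *)
Lemma hoelder_of_limit (w : 'rV[R]_d -> R) (c gamma : R) : 0 < c -> 0 < gamma ->
  (forall x, 0 <= w x <= 1) ->
  (forall (x z : 'rV[R]_d) h, 0 < h -> 0 <= w x - h ->
     (forall i, `|z ord0 i - x ord0 i| <= c * h `^ gamma^-1) -> w x - h <= w z) ->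
  hoelder_continuous gamma w.
Proof.
move=> c0 g0 w01 H; exists (c^-1 `^ gamma) => x y.
set r := enorm (x - y).
have r0 : 0 <= r by rewrite sqrtr_ge0.
have xy i : `|x ord0 i - y ord0 i| <= r.
  by have := enorm_ge_coord (x - y) i; rewrite !mxE.
have [rE|rn0] := eqVneq r 0.
  have -> : x = y.
    apply/rowP => i; apply/eqP; rewrite -subr_eq0 -normr_le0.
    by have := xy i; rewrite rE.
  by rewrite subrr normr0 mulr_ge0 ?powR_ge0.
have r_gt0 : 0 < r by rewrite lt_def rn0.
rewrite -powRM ?invr_ge0 ?(ltW c0)//; set h := (_ `^ gamma).
have h0 : 0 < h by rewrite powR_gt0// mulr_gt0// invr_gt0.
have hr : c * h `^ gamma^-1 = r.
  rewrite /h -powRrM mulfV ?gt_eqF// powRr1 ?mulr_ge0 ?invr_ge0 ?(ltW c0)//.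
  by rewrite mulrA divff ?mul1r// gt_eqF.
have low (x1 z1 : 'rV[R]_d) : (forall i, `|z1 ord0 i - x1 ord0 i| <= r) -> w x1 - h <= w z1.
  move=> xz; have [wh|wh] := leP 0 (w x1 - h); first by apply: H => //; rewrite hr.
  by apply: le_trans (ltW wh) _; case/andP: (w01 z1).
have l1 : w x - h <= w y by apply: low => i; rewrite distrC.
have l2 : w y - h <= w x by exact: low.
by rewrite ler_norml; apply/andP; split; lra.
Qed.

End hoelder.

Unset Implicit Arguments.

Theorem theorem2 (R : realType) (d : nat) (d_ge1 : (1 <= d)%N)
  (f : R -> 'rV[R]_d) (f_C2 : C2_in `[0, 1] f)
  (alpha : R) (f_nonlinear : alpha_nonlinear f alpha)
  (g : R * 'rV[R]_d -> R) (g_Loo : g \in Lfun (lebesgue_tx R d) +oo%E)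
  (u : R * 'rV[R]_d -> R) (u_cont : continuous u)
  (u_01 : forall z, u z \in `[0, 1])
  (u_sol : balance_solution f g u) (u_isentropic : isentropic f g u) :
  forall t : R, hoelder_continuous (alpha / (2 * d%:R)) (fun x => u (t, x)).
Proof.
move=> t.
have [/andP[alpha0 alpha1] [C C0 Hnl]] := f_nonlinear.
have [L L0 speedL] := speed_lipschitz f_C2.
have mg : measurable_fun [set: measurableTypeR R * 'rV[R]_d] g.
  exact: set_mem (sub_Lfun_mfun g_Loo).
have [G [g' [G0 mg' g'G gg']]] := Lfun_oo_bounded g_Loo.
have K0 : 0 <= solve_const (d := d) L.
  by rewrite /solve_const mulr_ge0// mulr_ge0// mulr_ge0// exprn_ge0// ltW.
have [c c0 Hc] := improvable_exists d_ge1 G0 L0 C0 K0 alpha0 alpha1 speedL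
  (solve_speeds f_C2 L0 speedL Hnl)
  (propagate f_C2 mg mg' G0 L0 g'G gg' u_cont u_01 u_isentropic speedL).
have dR0 : 0 < d%:R :> R by rewrite ltr0n.
apply: (hoelder_of_limit c0).
- by rewrite divr_gt0// mulr_gt0.
- by move=> x; have := u_01 (t, x); rewrite in_itv.
- move=> x z h h0 uh xz.
  have u1 : u (t, x) <= 1 by have := u_01 (t, x); rewrite in_itv/= => /andP[].
  apply: (improve_limit d_ge1 alpha0 alpha1 u_cont c0 Hc h0 u1 uh (lexx _)) => i.
  by have := xz i; rewrite invf_div.
Qed.
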